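(* Let $J$ be a non-empty set such that either $J\subset\{0,\ldots,\lfloor m/2\rfloor-1\}$ or $J\subset\{\lceil m/2\rceil,\ldots,m-1\}$. For each $j\in J$ choose disjoint sets $C_{j,+},C_{j,-}\subset\{0,\ldots,n-1\}$ with $C_{j,+}\cup C_{j,-}\neq\varnothing$. Consider the reflected carpet $K$ with digit set $D=\{(i,j): j\in J,\ i\in C_{j,+}\cup C_{j,-}\}$ and weak signs $\eta_{(i,j)}=1$ for $i\in C_{j,+}$ (weak map $y\mapsto (y+j)/m$) and $\eta_{(i,j)}=-1$ for $i\in C_{j,-}$ (weak map $y\mapsto(j+1-y)/m$), with the horizontal signs $\sigma_d\in\{-1,1\}$ arbitrary. Put $r_{j,+}=\#C_{j,+}$ and $r_{j,-}=\#C_{j,-}$. Then $$\dim_{\mathrm H} K=\frac{1}{\log m}\log\left(\sum_{j\in J}\bigl(r_{j,+}^{\beta}+r_{j,-}^{\beta}\bigr)\right),$$ where terms with zero count are interpreted as zero. If at least one $j\in J$ has $r_{j,+}r_{j,-}>0$, then this value is strictly larger than $$\frac{1}{\log m}\log\left(\sum_{j\in J}(r_{j,+}+r_{j,-})^{\beta}\right).$$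
   Context: Let $2\le m<n$ be integers and put $\beta=\log m/\log n$. Given a non-empty digit set $D\subset\{0,\ldots,n-1\}\times\{0,\ldots,m-1\}$ and signs $\sigma_d,\eta_d\in\{-1,1\}$ for $d=(i,j)\in D$, define $$S_d(x,y)=\left(\frac{\sigma_d x+a_d}{n},\frac{\eta_d y+b_d}{m}\right),$$ where $a_d=i$ if $\sigma_d=1$ and $a_d=i+1$ if $\sigma_d=-1$; and $b_d=j$ if $\eta_d=1$ and $b_d=j+1$ if $\eta_d=-1$. The reflected carpet $K$ is the attractor of $\{S_d:d\in D\}$, i.e. the unique non-empty compact set $K\subset\mathbb R^2$ with $K=\bigcup_{d\in D}S_d(K)$. The weak map of $d$ is the $y$-component of $S_d$, and $\sigma_d$ is the horizontal sign of $d$. $\dim_{\mathrm H}$ denotes Hausdorff dimension. *)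

(* Defs.v *)
From HB Require Import structures.
From mathcomp Require Import all_boot all_order all_algebra.
From mathcomp Require Import all_classical all_reals all_analysis.

Set Implicit Arguments.
Unset Strict Implicit.
Unset Printing Implicit Defensive.

Import Order.TTheory GRing.Theory Num.Theory.
Import numFieldNormedType.Exports.

Local Open Scope classical_set_scope.
Local Open Scope ring_scope.

Section HausdorffDimension.
Context {R : realType}.
Implicit Types (A U : set (R * R)) (s delta : R).

(* The norm of the product R * R is the sup norm, hence the explicit
   Euclidean distance. *)
Definition euclid_dist (p q : R * R) : R :=
  Num.sqrt ((p.1 - q.1) ^+ 2 + (p.2 - q.2) ^+ 2).

(* Adding 0 gives the empty set diameter 0 instead of -oo. *)
Definition ediam U : \bar R :=
  ereal_sup (0%E |` [set (euclid_dist p q)%:E | p in U & q in U]).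

(* The empty set is singled out because 0 `^ 0 = 1: it must have weight 0
   also for s = 0, where every nonempty set has weight 1. *)
Definition hweight s U : \bar R :=
  if U == set0 then 0%E else poweR (ediam U) s.

Definition delta_cover delta A (U : nat -> set (R * R)) : Prop :=
  A `<=` \bigcup_k U k /\ forall k, (ediam (U k) <= delta%:E)%E.

Definition hausdorff_premeasure s delta A : \bar R :=
  ereal_inf [set (\sum_(k <oo) hweight s (U k))%E | U in delta_cover delta A].

Definition hausdorff_measure s A : \bar R :=
  ereal_sup [set hausdorff_premeasure s delta A | delta in [set e | 0 < e]].

Definition hausdorff_dim A : \bar R :=
  ereal_inf [set s%:E | s in [set s | 0 <= s /\ hausdorff_measure s A = 0%E]].

End HausdorffDimension.

(* A sign in {1, -1} is encoded by the boolean b such that it equals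
   (-1) ^+ b, so that b = true is the reflected case; the translation part
   is then k when the sign is 1 and k + 1 when it is -1. *)
Definition digit_map {R : realType} (N k : nat) (b : bool) (t : R) : R :=
  ((-1) ^+ b * t + (k + b)%:R) / N%:R.

Definition carpet_map {R : realType} (m n : nat)
    (sigma eta : 'I_n * 'I_m -> bool) (d : 'I_n * 'I_m) (p : R * R) : R * R :=
  (digit_map n d.1 (sigma d) p.1, digit_map m d.2 (eta d) p.2).

Definition reflected_carpet {R : realType} (m n : nat)
    (D : {set 'I_n * 'I_m}) (sigma eta : 'I_n * 'I_m -> bool)
    (K : set (R * R)) : Prop :=
  [/\ K !=set0, compact K &
      K = \bigcup_(d in [set d | d \in D]) (carpet_map sigma eta d @` K)].

(* Main.v *)
(* Write r_w for the number of digits in row w = (j, eta), Z for the sum of the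
   r_w^beta, and gamma = log_m Z. The vertical projection of K lives in a half
   interval [h/2, (h+1)/2], which the weak maps send to intervals with disjoint
   interiors, two for each j; so K behaves like a Bedford-McMullen carpet in
   which the two orientations of a row count as two rows.
   Upper bound: an approximate square of strong level l and weak level k
   (n^-l ~ m^-k) with digits a and rows w_1 .. w_k is good if its McMullen mass
   Z^-k prod_{i<=k} r_{w_i}^beta / prod_{i<=l} r_{w_i} is at least
   Z^-k e^(-eps l). At most Z^k e^(eps l) squares of level l are good, and every
   point of K lies in a good square for one of boundedly many levels, since
   otherwise the averages (1/l) sum_{i<=l} ln r_{w_i} would drop below 0.
   Lower bound: by pigeonhole on the number of occurrences of each row, for large
   N the words of length N contain a family G whose fibres over row words all
   have the same size r, with #G r^(beta-1) >= m^(N s) for any given s < gamma.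
   A finite cover of K by boxes is then tested against the uniform distribution
   on long concatenations of words of G: each box of side e contains a proportion
   O(e^s) of them. *)
Require Import Defs.
From HB Require Import structures.
From mathcomp Require Import all_boot all_order all_algebra.
From mathcomp Require Import all_classical all_reals all_analysis.
From mathcomp Require Import zify ring lra.

Set Implicit Arguments.
Unset Strict Implicit.
Unset Printing Implicit Defensive.

Import Order.TTheory GRing.Theory Num.Theory.
Import numFieldNormedType.Exports.

Local Open Scope classical_set_scope.
Local Open Scope ring_scope.

(** * Words and cell codes *)

Section Words.
Local Open Scope nat_scope.
Context {T : eqType}.
Implicit Types (s : seq T) (L : nat).

Fixpoint words s L : seq (seq T) :=
  if L is L'.+1 then [seq x :: u | x <- s, u <- words s L'] else [:: [::]].

Lemma mem_words s L u : (u \in words s L) = (size u == L) && all [in s] u.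
Proof.
elim: L u => [|L IH] [|x u] //=; first by apply/negP => /allpairsP[[? ?] []].
rewrite eqSS; apply/allpairsP/and3P => [[[y v] /= [ys vs [-> ->]]]|[us xs au]].
  by move: vs; rewrite IH => /andP[-> ->].
by exists (x, u); split; rewrite ?IH ?us.
Qed.

Lemma count_wordsS (P : pred (seq T)) s L :
  count P (words s L.+1) = \sum_(x <- s) count (fun u => P (x :: u)) (words s L).
Proof.
rewrite /= count_flatten sumnE !big_map; apply: eq_bigr => x _.
by rewrite count_map; apply: eq_count.
Qed.

Lemma size_words s L : size (words s L) = size s ^ L.
Proof. by elim: L => //= L IH; rewrite size_allpairs IH expnS. Qed.

Lemma uniq_words s L : uniq s -> uniq (words s L).
Proof.
move=> s_uniq; elim: L => //= L IH; apply: allpairs_uniq => //.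
by move=> [x u] [y v] _ _ [-> ->].
Qed.

Lemma sum_words (A : comNzRingType) (F : T -> A) s L :
  (\sum_(u <- words s L) \prod_(x <- u) F x = (\sum_(x <- s) F x) ^+ L)%R.
Proof.
elim: L => [|L IH] /=; first by rewrite big_seq1 big_nil GRing.expr0.
rewrite big_allpairs_dep GRing.exprS GRing.mulr_suml; apply: eq_bigr => x _.
by rewrite -IH GRing.mulr_sumr; apply: eq_bigr => u _; rewrite big_cons.
Qed.

Lemma count_map_words (U : eqType) (f : T -> U) s L b : size b = L ->
  count (fun u => map f u == b) (words s L) =
  \prod_(y <- b) count (fun x => f x == y) s.
Proof.
elim: b L => [|y b IH] [|L] //=; first by rewrite big_nil.
case=> sb; rewrite count_wordsS big_cons -sum1_count big_distrl /= [RHS]big_mkcond /=.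
apply: eq_bigr => x _; rewrite -(IH L) //; case: ifP => fxy.
  by rewrite mul1n; apply: eq_count => u /=; rewrite eqseq_cons fxy.
by rewrite -(count_pred0 (words s L)); apply: eq_count => u /=; rewrite eqseq_cons fxy.
Qed.

(** The first l letters are forced, each of the next k - l ranges over one fibre of [f], and the
    last B - k are free. Later the letters are blocks and [f] reads off their rows, so that the
    class is an approximate square. *)
Lemma count_class_words (U : eqType) (f : T -> U) s r (v0 : seq T) l k B :
    uniq s -> (forall y, count (fun x => f x == y) s <= r) ->
    size v0 = B -> l <= k <= B ->
  count (fun v => (take l v == take l v0) && (map f (take k v) == map f (take k v0)))
    (words s B) <= r ^ (k - l) * size s ^ (B - k).
Proof.
move=> s_uniq fr; elim: B v0 l k => [|B IH] v0 l k.
  by case: v0 => // _ /andP[]; case: k => // + _; case: l.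
case: v0 => //= x0 v0 [sv0]; case: k => [|k].
  case: l => // _; rewrite mul1n subn0 -size_words /=.
  by rewrite (leq_trans (count_size _ _)).
move=> /andP[lk kB]; rewrite count_wordsS /=.
case: l lk => [_|l lk].
  rewrite subn0 subSS expnS -mulnA.
  apply: (@leq_trans (\sum_(x <- s) (f x == f x0) * (r ^ k * size s ^ (B - k)))).
    apply: leq_sum => x _; case: eqP => /= [fx|fx].
      rewrite mul1n -[k in r ^ k]subn0 (leq_trans _ (IH v0 0 k sv0 kB)) //.
      by rewrite leq_eqVlt; apply/orP; left; apply/eqP/eq_count => v; rewrite !take0 /= eqseq_cons fx !eqxx.
    rewrite mul0n leqn0 -(count_pred0 (words s B)); apply/eqP/eq_count => v /=.
    by rewrite eqseq_cons; case: eqP fx.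
  rewrite -big_distrl /= leq_mul2r; apply/orP; right.
  by rewrite (leq_trans _ (fr (f x0))) // -sum1_count [leqRHS]big_mkcond /=; apply: leq_sum => x _; case: eqP.
rewrite !subSS; apply: (@leq_trans (\sum_(x <- s) (x == x0) * (r ^ (k - l) * size s ^ (B - k)))).
  apply: leq_sum => x _; case: eqP => /= [->|xx0].
    rewrite mul1n (leq_trans _ (IH v0 l k sv0 _)) //; last by rewrite -ltnS lk.
    by rewrite leq_eqVlt; apply/orP; left; apply/eqP/eq_count => v; rewrite /= !eqseq_cons !eqxx.
  rewrite mul0n leqn0 -(count_pred0 (words s B)); apply/eqP/eq_count => v /=.
  by rewrite eqseq_cons; case: eqP xx0.
rewrite -big_distrl /= -[leqRHS]mul1n leq_mul2r; apply/orP; right.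
have <- : count_mem x0 s = \sum_(x <- s) (x == x0).
  by rewrite -sum1_count big_mkcond /=; apply: eq_bigr => x _; case: eqP.
by rewrite count_uniq_mem // leq_b1.
Qed.

Lemma leq_size_fibres (I : finType) (f : T -> I) F s :
  (forall i, count (fun x => f x == i) s <= F) -> size s <= #|I| * F.
Proof.
move=> fF; rewrite -sum_nat_const -sum1_size.
have -> : \sum_(x <- s) 1 = \sum_(x <- s) \sum_i (f x == i).
  by apply: eq_bigr => x _; rewrite (bigD1 (f x)) //= eqxx big1 // => i /negPf; rewrite eq_sym => ->.
rewrite exchange_big /=; apply: leq_sum => i _; apply: leq_trans (fF i).
by rewrite -sum1_count [leqRHS]big_mkcond /=; apply: leq_sum => x _; case: eqP.
Qed.

End Words.

(** * Integer codes of cells and their injectivity *)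

Section Codes.
Local Open Scope nat_scope.

(** Reversing an interval cut into M equal cells renumbers the cells from the other end. *)
Definition reflect_code (M : nat) (b : bool) (c : nat) := if b then M - c.+1 else c.

(* [cell_code A c0 N w] indexes the image of [c0/A, (c0+1)/A] under the composition
   of the digit maps in [w], among the intervals of length 1/(A N^|w|). *)
Fixpoint cell_code (A c0 N : nat) (w : seq (nat * bool)) : nat :=
  if w is (k, b) :: w' then
    let M := A * N ^ size w' in k * M + reflect_code M b (cell_code A c0 N w')
  else c0.

Definition digits_below (N : nat) (w : seq (nat * bool)) := all (fun d => d.1 < N) w.

Lemma reflect_code_lt M b c : c < M -> reflect_code M b c < M.
Proof. by rewrite /reflect_code; case: b => //; lia. Qed.

Lemma reflect_code_inj M b c c' : c < M -> c' < M ->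
  reflect_code M b c = reflect_code M b c' -> c = c'.
Proof. by rewrite /reflect_code; case: b => //; lia. Qed.

Lemma digit_inj M k k' c c' : c < M -> c' < M ->
  k * M + c = k' * M + c' -> k = k' /\ c = c'.
Proof.
move=> cM c'M e; have M0 : 0 < M by lia.
have := congr1 (divn^~ M) e; rewrite /= !divnMDl // !divn_small // !addn0 => kk.
by split=> //; move: e; rewrite kk => /addnI.
Qed.

Lemma cell_code_lt A c0 N w : c0 < A -> digits_below N w -> cell_code A c0 N w < A * N ^ size w.
Proof.
move=> cA; elim: w => [|[k b] w IH] /=; first by rewrite muln1.
move=> /andP[kN wN]; set M := A * _ ^ size w.
have := reflect_code_lt b (IH wN); rewrite -/M => rM.
rewrite expnS mulnCA -/M (@leq_trans (k.+1 * M)) // ?leq_mul2r ?kN ?orbT //.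
by rewrite mulSn addnC ltn_add2r.
Qed.

(* The weak digits stay in the half indexed by h: h = 0 is the lower one. *)
Definition half_digits (h m : nat) (w : seq (nat * bool)) :=
  all (fun d => (h * m <= 2 * d.1) && (2 * d.1.+1 <= h.+1 * m)) w.

Lemma half_digits_below h m w : h <= 1 -> half_digits h m w -> digits_below m w.
Proof. by move=> h1; apply: sub_all => d /andP[_]; nia. Qed.

(** For a nonempty word the first digit alone confines the cell to the half h, whatever the
    orientations and the tail; for the empty word the cell is that half itself. *)
Lemma half_code_bounds h m w : h <= 1 -> half_digits h m w ->
  h * m ^ size w <= cell_code 2 h m w < h.+1 * m ^ size w.
Proof.
move=> h1; case: w => [|[j b] w] /=; first by rewrite !muln1 ltnS leqnn.
move=> /andP[/andP[lo hi] wm].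
have := reflect_code_lt b (cell_code_lt (h1 : h < 2) (half_digits_below h1 wm)).
set M := m ^ size w; set c := reflect_code _ _ _.
rewrite expnS -/M !mulnA => cM.
have : h * m * M <= 2 * j * M by rewrite leq_mul2r lo orbT.
have : 2 * j.+1 * M <= h.+1 * m * M by rewrite leq_mul2r hi orbT.
by nia.
Qed.

(** Division recovers the first digit, the position of the remainder reveals the orientation, and
    the tail follows by induction. This is where confining the rows to one half enters. *)
Lemma half_code_inj h m w w' : h <= 1 -> half_digits h m w -> half_digits h m w' ->
  size w = size w' -> cell_code 2 h m w = cell_code 2 h m w' -> w = w'.
Proof.
move=> h1; elim: w w' => [|[j b] w IH] [|[j' b'] w'] //= /andP[jm wm] /andP[jm' wm'] [ss].
have c := cell_code_lt (h1 : h < 2) (half_digits_below h1 wm).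
have c' := cell_code_lt (h1 : h < 2) (half_digits_below h1 wm').
rewrite -ss in c' * => /digit_inj[||-> e]; try exact: reflect_code_lt.
(* The code of each tail lies in the half h and its reflection in the other half, so equal
   remainders come from equal orientations. *)
have bb' : b = b'.
  have := half_code_bounds h1 wm; have := half_code_bounds h1 wm'.
  rewrite -ss; move: e c c'; rewrite /reflect_code.
  move: (cell_code _ _ _ w) (cell_code _ _ _ w') => x y.
  by case: (h) h1 => [|[|//]] _; case: (b); case: (b') => //; rewrite ?mul1n; lia.
rewrite -bb' in e *; congr (_ :: _); apply: IH => //.
by move: e; apply: reflect_code_inj.
Qed.

End Codes.

(** * Digit maps *)

Section DigitMaps.
Context {R : realType}.
Implicit Types (S : set R) (t : R).

Definition in_cell (L c : nat) t := c%:R / L%:R <= t <= c.+1%:R / L%:R.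

Lemma in_cell_digit_map (N M k c : nat) b t : (0 < N)%N -> (c < M)%N ->
  in_cell M c t -> in_cell (N * M)%N (k * M + reflect_code M b c)%N (digit_map N k b t).
Proof.
move=> N0 cM; have M0 : (0 < M)%N by lia.
have NR : (0 : R) < N%:R by rewrite ltr0n.
have MR : (0 : R) < M%:R by rewrite ltr0n.
rewrite /in_cell /digit_map natrM => /andP[].
rewrite ler_pdivrMr // ler_pdivlMr // => h1 h2.
rewrite ler_pdivrMr ?mulr_gt0 // ler_pdivlMr ?mulr_gt0 //.
set T := (_ / N%:R * _); have -> : T = ((-1) ^+ b * t + (k + b)%:R) * M%:R.
  by rewrite /T; field; rewrite gt_eqF.
rewrite {T} /reflect_code; case: b => /=.
  rewrite expr1 -[(_ + _).+1]addn1 !natrD natrM natrB // -natr1 in h2 *.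
  by apply/andP; split; lra.
rewrite expr0 addn0 -[(_ + _).+1]addn1 !natrD natrM -natr1 in h2 *.
by apply/andP; split; lra.
Qed.

Definition digit_maps (N : nat) (w : seq (nat * bool)) t :=
  foldr (fun d => digit_map N d.1 d.2) t w.

Lemma in_cell_code (A c0 N : nat) w t : (0 < N)%N -> (c0 < A)%N ->
  digits_below N w -> in_cell A c0 t ->
  in_cell (A * N ^ size w)%N (cell_code A c0 N w) (digit_maps N w t).
Proof.
move=> N0 cA + tA; elim: w => [|[k b] w IH] /=; first by rewrite muln1.
move=> /andP[kN wN]; rewrite expnS mulnCA.
by apply: in_cell_digit_map => //; [apply: cell_code_lt | apply: IH].
Qed.

Lemma digit_map_center (N k : nat) b t : (0 < N)%N ->
  digit_map N k b t - 2^-1 = ((-1) ^+ b * (t - 2^-1) + (k%:R + 2^-1 - N%:R / 2)) / N%:R.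
Proof.
move=> N0; rewrite /digit_map; case: b => /=; rewrite ?expr1 ?expr0 ?natrD; field;
  by rewrite pnatr_eq0 -lt0n.
Qed.

(** With s the supremum of |t - 1/2| over [S], the centred form of the digit maps gives s <= (s + (N
    - 1)/2)/N, whence s <= 1/2. *)
Lemma digit_invariant_unit (N : nat) S : (2 <= N)%N -> bounded_set S ->
  (forall t, S t -> exists k b t', [/\ (k < N)%N, S t' & t = digit_map N k b t']) ->
  forall t, S t -> 0 <= t <= 1.
Proof.
move=> N2 bS hS t0 St0.
have NR : (2 : R) <= N%:R by rewrite ler_nat.
pose E := [set `|t - 2^-1| | t in S].
have ubE : has_ubound E.
  have [M [_ hM]] := bS; exists (M + 1 + 2^-1) => _ [t St <-].
  rewrite (le_trans (ler_normB _ _)) // [`|2^-1|]ger0_norm ?invr_ge0 // lerD2r.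
  by apply: hM => //; rewrite ltrDl.
have leE t : S t -> `|t - 2^-1| <= sup E by move=> St; apply: ub_le_sup => //; exists t.
have supE : sup E <= (sup E + (N%:R - 1) / 2) / N%:R.
  apply: ge_sup; first by exists `|t0 - 2^-1|, t0.
  move=> _ [t St <-]; have [k [b [t' [kN St' ->]]]] := hS _ St.
  rewrite digit_map_center ?(ltn_trans _ N2) // normrM [`|N%:R^-1|]ger0_norm ?invr_ge0 //.
  rewrite ler_wpM2r ?invr_ge0 // (le_trans (ler_normD _ _)) // lerD //.
    by rewrite normrM normrX normrN normr1 expr1n mul1r leE.
  have kN' : (k%:R : R) + 1 <= N%:R by rewrite natr1 ler_nat.
  have k0 : (0 : R) <= k%:R by [].
  by rewrite ler_norml; apply/andP; split; lra.
rewrite ler_pdivlMr in supE; last by lra.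
have : sup E <= 2^-1 by nra.
have := leE _ St0; rewrite ler_norml => /andP[]; lra.
Qed.

End DigitMaps.

(** * Words of digits acting on the carpet *)

Section CarpetWords.
Context {R : realType} {m n : nat}.
Context (D : {set 'I_n * 'I_m}) (sigma eta : 'I_n * 'I_m -> bool).
Implicit Types (u v : seq ('I_n * 'I_m)) (b : seq ('I_m * bool)) (p q : R * R).

Definition weak_row (d : 'I_n * 'I_m) : 'I_m * bool := (d.2, eta d).

Definition strong_code u := cell_code 1 0 n [seq (val d.1, sigma d) | d <- u].

Definition weak_code (h : nat) b := cell_code 2 h m [seq (val w.1, w.2) | w <- b].

(* The approximate square: the first [size u] digits are prescribed, and the
   first [size b] rows. *)
Definition in_square (h : nat) u b p :=
  in_cell (n ^ size u)%N (strong_code u) p.1 /\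
  in_cell (2 * m ^ size b)%N (weak_code h b) p.2.

Definition word_map u q := foldr (carpet_map sigma eta) q u.

Lemma word_map1 u q : (word_map u q).1 = digit_maps n [seq (val d.1, sigma d) | d <- u] q.1.
Proof. by elim: u => //= d u IH; rewrite IH. Qed.

Lemma word_map2 u q :
  (word_map u q).2 = digit_maps m [seq (val w.1, w.2) | w <- map weak_row u] q.2.
Proof. by elim: u => //= d u IH; rewrite IH. Qed.

Lemma word_map_cat u v q : word_map (u ++ v) q = word_map u (word_map v q).
Proof. exact: foldr_cat. Qed.

Lemma digits_below_ord (N : nat) (T : Type) (f : T -> 'I_N) (g : T -> bool) (u : seq T) :
  digits_below N [seq (val (f d), g d) | d <- u].
Proof. by elim: u => //= d u ->; rewrite ltn_ord. Qed.

Lemma strong_code_lt u : (strong_code u < n ^ size u)%N.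
Proof.
rewrite /strong_code -[X in (_ < X)%N]mul1n.
rewrite -(size_map (fun d : 'I_n * 'I_m => (val d.1, sigma d)) u).
by apply: cell_code_lt => //; apply: digits_below_ord.
Qed.

(** The same column may occur in several rows. Once the rows are known, the leading strong digit
    gives the whole letter, hence its horizontal sign, and the reflection of the tail can be
    undone. *)
Lemma strong_code_inj u v : map weak_row u = map weak_row v ->
  strong_code u = strong_code v -> u = v.
Proof.
elim: u v => [|[i j] u IH] [|[i' j'] v] //= [jj ee uv].
have suv : size u = size v by rewrite -(size_map weak_row u) uv size_map.
have := strong_code_lt u; have := strong_code_lt v; rewrite -suv => vlt ult.
rewrite /strong_code /= -/(strong_code u) -/(strong_code v) !size_map -suv !mul1n.
move=> /digit_inj[||ii e]; try exact: reflect_code_lt.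
have {jj ee}dd : (i, j) = (i', j') by congr pair => //; apply: val_inj.
by rewrite dd in e *; congr (_ :: _); apply: IH => //; move: e; apply: reflect_code_inj.
Qed.

Definition half_row (h : nat) (w : 'I_m * bool) :=
  (h * m <= 2 * w.1)%N && (2 * w.1.+1 <= h.+1 * m)%N.

Lemma weak_code_inj h b b' : (h <= 1)%N -> all (half_row h) b -> all (half_row h) b' ->
  size b = size b' -> weak_code h b = weak_code h b' -> b = b'.
Proof.
move=> h1 bh b'h sb /(half_code_inj h1) e.
apply: (@inj_map _ _ (fun w : 'I_m * bool => (val w.1, w.2))).
  by move=> [x1 x2] [y1 y2] [/val_inj -> ->].
by apply: e; rewrite ?size_map // /half_digits all_map.
Qed.

Context (hm : (2 <= m)%N) (hmn : (m < n)%N) (h : nat) (h1 : (h <= 1)%N).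
Context (Dh : forall d, d \in D -> half_row h (weak_row d)).
Context (K : set (R * R)) (hK : reflected_carpet D sigma eta K).

Let n2 : (2 <= n)%N. Proof. lia. Qed.

Lemma carpet_in q : K q -> exists2 d, d \in D & exists2 q', K q' & q = carpet_map sigma eta d q'.
Proof.
case: hK => _ _ hKE; rewrite {1}hKE => -[d /= dD [q' Kq' <-]].
by exists d => //; exists q'.
Qed.

Lemma carpet_sub d q : d \in D -> K q -> K (carpet_map sigma eta d q).
Proof.
by case: hK => _ _ hKE dD Kq; rewrite hKE; exists d => //; exists q.
Qed.

Lemma word_map_sub u q : all [in D] u -> K q -> K (word_map u q).
Proof.
by elim: u => //= d u IH /andP[dD uD] Kq; apply: carpet_sub => //; apply: IH.
Qed.

Lemma word_map_in L q : K q ->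
  exists u, [/\ u \in words (enum D) L & exists2 q', K q' & q = word_map u q'].
Proof.
elim: L q => [|L IH] q Kq; first by exists [::]; split => //; exists q.
have [d dD [q1 /IH[u [uL [q' Kq' ->]]] ->]] := carpet_in Kq.
exists (d :: u); split; last by exists q'.
by move: uL; rewrite !mem_words /= eqSS mem_enum dD.
Qed.

Lemma bounded_carpet : exists M : R, forall q, K q -> `|q.1| <= M /\ `|q.2| <= M.
Proof.
case: hK => _ /compact_bounded[M [_ hM]] _; exists (M + 1) => q Kq.
have := hM (M + 1) ltac:(by rewrite ltrDl) _ Kq.
by rewrite /= prod_normE ge_max => /andP.
Qed.

Lemma bounded_set_norm_le (S : set R) (M : R) : (forall t, S t -> `|t| <= M) -> bounded_set S.
Proof.
move=> SM; exists M; split; first exact: num_real.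
by move=> x Mx t St; apply: (le_trans (SM _ St)); apply: ltW.
Qed.

(** Both projections are bounded and consist of images of their own points under digit maps, so they
    lie in [0, 1]. One more weak map, whose digit is in the half h, puts the second coordinate into
    that half. *)
Lemma carpet_cell q : K q -> in_cell 1 0 q.1 /\ in_cell 2 h q.2.
Proof.
have [M hM] := bounded_carpet.
have unit1 : forall t, [set q.1 | q in K] t -> 0 <= t <= 1.
  apply: (@digit_invariant_unit _ n) => //.
    by apply: (bounded_set_norm_le (M := M)) => _ [q' /hM[? ?] <-].
  move=> _ [q' /carpet_in[d dD [q1 Kq1 ->]] <-].
  by exists d.1, (sigma d), q1.1; split => //; exists q1.
have unit2 : forall t, [set q.2 | q in K] t -> 0 <= t <= 1.
  apply: (@digit_invariant_unit _ m) => //.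
    by apply: (bounded_set_norm_le (M := M)) => _ [q' /hM[? ?] <-].
  move=> _ [q' /carpet_in[d dD [q1 Kq1 ->]] <-].
  by exists d.2, (eta d), q1.2; split => //; exists q1.
move=> Kq; split; first by rewrite /in_cell mul0r divr1 unit1 //; exists q.
have [d dD [q1 Kq1 ->]] := carpet_in Kq.
have c1 : in_cell 1 0 q1.2 by rewrite /in_cell mul0r divr1 unit2 //; exists q1.
have m0 : (0 < m)%N by lia.
have := in_cell_digit_map d.2 (eta d) m0 (ltnSn 0) c1.
have -> : reflect_code 1 (eta d) 0 = 0%N by rewrite /reflect_code; case: eta.
rewrite /in_cell !muln1 addn0 /= => /andP[lo hi].
have /andP[dlo dhi] := Dh dD.
have mR : (0 : R) < m%:R by rewrite ltr0n.
apply/andP; split.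
  apply: le_trans lo; rewrite ler_pdivlMr // mulrAC ler_pdivrMr // -!natrM ler_nat.
  by rewrite [(d.2 * 2)%N]mulnC.
apply: le_trans hi _; rewrite ler_pdivrMr // mulrAC ler_pdivlMr // -!natrM ler_nat.
by rewrite mulnC.
Qed.

(** Cut [v] after l letters for the first coordinate and after k letters for the second; in both
    cases the rest of the word sends [q] into [K], where [carpet_cell] applies. *)
Lemma in_square_word_map (l k : nat) v q : all [in D] v -> K q ->
  in_square h (take l v) (map weak_row (take k v)) (word_map v q).
Proof.
move=> vD Kq; split.
  rewrite -{3}(cat_take_drop l v) word_map_cat word_map1.
  have Kd : K (word_map (drop l v) q).
    by apply: word_map_sub => //; move: vD; rewrite -{1}(cat_take_drop l v) all_cat => /andP[].
  have := @in_cell_code _ 1 0 n [seq (val d.1, sigma d) | d <- take l v] _ _ _ _ (carpet_cell Kd).1.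
  rewrite size_map mul1n; apply => //; first by lia.
  exact: digits_below_ord.
rewrite -{3}(cat_take_drop k v) word_map_cat word_map2.
have Kd : K (word_map (drop k v) q).
  by apply: word_map_sub => //; move: vD; rewrite -{1}(cat_take_drop k v) all_cat => /andP[].
have := @in_cell_code _ 2 h m [seq (val w.1, w.2) | w <- map weak_row (take k v)] _ _ _ _ (carpet_cell Kd).2.
rewrite size_map; apply => //; first by lia.
exact: digits_below_ord.
Qed.

End CarpetWords.

(** * Hausdorff measure *)

Section Hausdorff.
Context {R : realType}.
Implicit Types (A U : set (R * R)) (s : R).

Lemma ediam_ge0 U : (0 <= ediam U)%E.
Proof. by apply: ereal_sup_ubound; left. Qed.

Lemma ediam_le U (d : R) : 0 <= d ->
  (forall p q, U p -> U q -> euclid_dist p q <= d) -> (ediam U <= d%:E)%E.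
Proof.
by move=> d0 Ud; apply: ge_ereal_sup => _ [->|[p Up [q Uq <-]]]; rewrite lee_fin // Ud.
Qed.

Lemma euclid_dist_le_ediam U p q : U p -> U q -> ((euclid_dist p q)%:E <= ediam U)%E.
Proof. by move=> Up Uq; apply: ereal_sup_ubound; right; exists p => //; exists q. Qed.

Lemma hweight_ge0 s U : (0 <= hweight s U)%E.
Proof. by rewrite /hweight; case: ifP => // _; rewrite poweR_ge0. Qed.

Lemma hweight_le s U (d : R) : 0 <= s -> (ediam U <= d%:E)%E ->
  (hweight s U <= (d `^ s)%:E)%E.
Proof.
move=> s0 Ud; rewrite /hweight; case: ifP => _; first by rewrite lee_fin powR_ge0.
by rewrite -poweR_EFin gt0_ler_poweR // in_itv /= ?ediam_ge0 ?(le_trans (ediam_ge0 U) Ud) // leey.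
Qed.

Lemma hausdorff_measure0_cover s A : hausdorff_measure s A = 0%E ->
  forall eps : R, 0 < eps -> exists2 U, delta_cover 1 A U &
    (\sum_(k <oo) hweight s (U k) < eps%:E)%E.
Proof.
move=> HA eps eps0; have : (hausdorff_premeasure s 1 A < eps%:E)%E.
  apply: (@le_lt_trans _ _ 0%E); last by rewrite lte_fin.
  by rewrite -HA; apply: ereal_sup_ubound; exists 1 => //=.
by move=> /ereal_inf_lt[_ [U ? <-]]; exists U.
Qed.

Lemma sum_geometric_half N : \sum_(0 <= k < N) (2%:R ^- k.+1 : R) = 1 - 2%:R ^- N.
Proof.
elim: N => [|N IH]; first by rewrite big_nil expr0 invr1 subrr.
by rewrite big_nat_recr //= IH exprS; field; rewrite expf_neq0.
Qed.

Definition box (x : R * R) (r : R) : set (R * R) :=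
  [set p | `|p.1 - x.1| < r /\ `|p.2 - x.2| < r].

Lemma euclid_dist_coord (p q : R * R) :
  `|p.1 - q.1| <= euclid_dist p q /\ `|p.2 - q.2| <= euclid_dist p q.
Proof.
by split; rewrite -sqrtr_sqr ler_wsqrtr // ?lerDl ?lerDr sqr_ge0.
Qed.

(** Arbitrary covering sets are replaced by open boxes, so that compactness can extract a finite
    subcover. *)
Lemma hausdorff_measure0_boxes s A : 0 < s -> hausdorff_measure s A = 0%E ->
  forall eps : R, 0 < eps -> exists (x : nat -> R * R) (r : nat -> R),
    [/\ forall k, 0 < r k, A `<=` \bigcup_k box (x k) (r k) &
        forall N, \sum_(0 <= k < N) (r k `^ s) <= eps].
Proof.
move=> s0 HA eps eps0; have eps2 : 0 < eps / 2 by rewrite divr_gt0.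
have [U [AU Ud] Usum] := hausdorff_measure0_cover HA eps2.
pose eta k : R := eps / 2 * 2%:R ^- k.+1.
have eta0 k : 0 < eta k by rewrite !mulr_gt0 // invr_gt0 exprn_gt0.
have hfin k : hweight s (U k) \is a fin_num.
  rewrite ge0_fin_numE ?hweight_ge0 //.
  by apply: le_lt_trans (hweight_le (ltW s0) (Ud k)) _; rewrite ltry.
pose w k := fine (hweight s (U k)).
have w0 k : 0 <= w k by rewrite fine_ge0 ?hweight_ge0.
(* Enlarging the weights by [eta k], of total at most eps / 2, makes each radius positive and
   strictly larger than the diameter, even if the diameter is 0. *)
pose r k := (w k + eta k) `^ s^-1.
have weta k : 0 < w k + eta k by rewrite ltr_wpDl.
have rs k : r k `^ s = w k + eta k.
  by rewrite -powRrM mulVf ?gt_eqF // powRr1 // ltW.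
have r0 k : 0 < r k by rewrite powR_gt0.
have /choice[x hx] : forall k, exists x, U k `<=` box x (r k).
  move=> k; have [->|/set0P[x Ux]] := eqVneq (U k) set0; first by exists (0, 0).
  exists x => p Up; have := euclid_dist_le_ediam Up Ux.
  have dfin : ediam (U k) \is a fin_num.
    by rewrite ge0_fin_numE ?ediam_ge0 // (le_lt_trans (Ud k)) // ltry.
  rewrite -(fineK dfin) lee_fin => pxd.
  have dr : fine (ediam (U k)) < r k.
    have d0 : 0 <= fine (ediam (U k)) by rewrite fine_ge0 ?ediam_ge0.
    rewrite -[ltLHS](powRr1 d0) -(mulfV (lt0r_neq0 s0)) powRrM.
    have -> : fine (ediam (U k)) `^ s = w k.
      rewrite /w /hweight ifF; last by apply/negP => /eqP U0; rewrite U0 in Ux.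
      by rewrite -[in RHS](fineK dfin) poweR_EFin.
    by apply: gt0_ltr_powR; rewrite ?invr_gt0 ?nnegrE ?w0 ?(ltW (weta k)) ?ltrDl.
  by have [h1 h2] := euclid_dist_coord p x; split;
    apply: le_lt_trans dr; apply: le_trans pxd.
exists x, r; split => // [p /AU[k _ Uk]|N]; first by exists k => //; apply: hx.
under eq_bigr do rewrite rs.
rewrite big_split /= (splitr eps) lerD //; last first.
  rewrite -mulr_sumr sum_geometric_half ler_piMr ?divr_ge0 ?ltW // lerBlDr lerDl.
rewrite -lee_fin -sumEFin; apply: le_trans (ltW Usum).
under eq_bigr do rewrite /w fineK //.
by apply: nneseries_lim_ge => k _; rewrite hweight_ge0.
Qed.

Lemma sum_nth_le (T : Type) (f : T -> R) (x0 : T) (u : seq T) N :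
  (forall x, 0 <= f x) -> f x0 = 0 ->
  \sum_(0 <= k < N) f (nth x0 u k) <= \sum_(x <- u) f x.
Proof.
move=> f0 fx0; elim: u N => [|x u IH] N.
  by rewrite big_nil big1 // => k _; rewrite nth_nil.
case: N => [|N]; first by rewrite big_nil sumr_ge0.
by rewrite big_nat_recl //= big_cons lerD2l IH.
Qed.

(** A finite list is padded to a sequence with the pair [(set0, 0)], which adds nothing to the sum
    because s > 0. *)
Lemma hausdorff_measure_eq0 s A : 0 < s ->
  (forall delta eps : R, 0 < delta -> 0 < eps -> exists Us : seq (set (R * R) * R),
    [/\ forall x, A x -> exists2 U : set (R * R) * R, U \in Us & U.1 x,
        forall U : set (R * R) * R, U \in Us -> 0 <= U.2 <= delta /\ (ediam U.1 <= U.2%:E)%E &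
        \sum_(U <- Us) U.2 `^ s <= eps]) ->
  hausdorff_measure s A = 0%E.
Proof.
move=> s0 hA; apply/eqP; rewrite eq_le; apply/andP; split; last first.
  apply: (@le_trans _ _ (hausdorff_premeasure s 1 A)).
    by apply: le_ereal_inf_tmp => _ [U _ <-]; apply: nneseries_ge0 => k _ _; rewrite hweight_ge0.
  by apply: ereal_sup_ubound; exists 1 => //=.
apply: ge_ereal_sup => _ [delta /= delta0 <-].
apply/lee_addgt0Pr => eps eps0; rewrite add0e.
have [Us [cov Ud Usum]] := hA _ _ delta0 eps0.
pose x0 : set (R * R) * R := (set0, 0).
have ediam0 : (ediam (@set0 (R * R)) <= 0%:E)%E by apply: ediam_le.
have nthU k : 0 <= (nth x0 Us k).2 <= delta /\ (ediam (nth x0 Us k).1 <= (nth x0 Us k).2%:E)%E.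
  have [kU|Uk] := ltnP k (size Us); first by apply: Ud; rewrite mem_nth.
  by rewrite nth_default //= lexx ltW.
apply: (@le_trans _ _ (\sum_(k <oo) hweight s (nth x0 Us k).1)%E).
  apply: ereal_inf_lbound; exists (fun k => (nth x0 Us k).1) => //; split.
    by move=> x /cov[U UU Ux]; exists (index U Us) => //; rewrite nth_index.
  move=> k; have [/andP[_ d] /le_trans] := nthU k; apply.
  by rewrite lee_fin.
apply: lime_le; first by apply: is_cvg_nneseries => k _ _; rewrite hweight_ge0.
near=> N; apply: (@le_trans _ _ (\sum_(0 <= k < N) ((nth x0 Us k).2 `^ s)%:E)%E).
  by apply: lee_sum => k _; apply: hweight_le; [exact: ltW | exact: (nthU k).2].
rewrite sumEFin lee_fin; apply: le_trans Usum.
apply: (sum_nth_le (f := fun U : set (R * R) * R => U.2 `^ s)) => [x|]; first exact: powR_ge0.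
by rewrite powR0 // gt_eqF.
Unshelve. all: by end_near.
Qed.

(** For s = 0 each nonempty member of a cover weighs 1, so no cover of a nonempty set has total
    weight below 1. *)
Lemma hausdorff_measure0_neq0 A : A !=set0 -> hausdorff_measure 0 A <> 0%E.
Proof.
move=> [x Ax] /hausdorff_measure0_cover/(_ 1 ltr01)[U [AU _]].
have [k _ Uk] := AU _ Ax; apply/negP; rewrite -leNgt.
have hk : hweight 0 (U k) = 1%E.
  by rewrite /hweight ifF ?poweRe0 //; apply/negP => /eqP U0; rewrite U0 in Uk.
apply: (@le_trans _ _ (\sum_(0 <= i < k.+1) hweight 0 (U i))%E); last first.
  by apply: nneseries_lim_ge => i _; rewrite hweight_ge0.
by rewrite big_nat_recr //= hk leeDr // sume_ge0 // => i _; rewrite hweight_ge0.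
Qed.

Lemma hausdorff_dim_eq A (v : R) : 0 <= v ->
  (forall s, v < s -> hausdorff_measure s A = 0%E) ->
  (forall s, 0 <= s -> s < v -> hausdorff_measure s A <> 0%E) ->
  hausdorff_dim A = v%:E.
Proof.
move=> v0 up lo; apply/eqP; rewrite eq_le; apply/andP; split.
  apply/lee_addgt0Pr => e e0; rewrite -EFinD; apply: ereal_inf_lbound.
  by exists (v + e) => //; split; [rewrite addr_ge0 // ltW | apply: up; rewrite ltrDl].
apply: le_ereal_inf_tmp => _ [s [s0 Hs] <-]; rewrite lee_fin leNgt; apply/negP => sv.
exact: (lo s s0 sv Hs).
Qed.

End Hausdorff.

(** * Approximate squares *)

Section Levels.
Context {R : realType} {m n : nat} (hm : (2 <= m)%N) (hmn : (m < n)%N).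

(* Squares of strong level l have height m^-(weak_level l), comparable to
   their width n^-l. *)
Definition weak_level (l : nat) : nat := up_log m (n ^ l).

Lemma weak_levelP l : (n ^ l <= m ^ weak_level l)%N.
Proof. exact: up_logP. Qed.

Lemma weak_level_upper l : (m ^ weak_level l <= m * n ^ l)%N.
Proof.
rewrite /weak_level; case: l => [|l]; first by rewrite up_log1 muln1; lia.
have n1 : (1 < n ^ l.+1)%N by rewrite -{1}(exp1n l.+1) ltn_exp2r; lia.
have := up_log_gtn hm n1; case: (up_log m _) => [|k] /= lt.
  by nia.
by rewrite expnS leq_mul2l ltnW ?orbT.
Qed.

Lemma leq_weak_level l : (l <= weak_level l)%N.
Proof.
rewrite -(leq_exp2l _ _ hm) (leq_trans _ (weak_levelP l)) //.
by case: l => // l; rewrite leq_exp2r // ltnW.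
Qed.

Let lnm : 0 < ln m%:R :> R. Proof. by rewrite ln_gt0 // ltr1n. Qed.
Let lnn : 0 < ln n%:R :> R. Proof. by rewrite ln_gt0 // ltr1n; lia. Qed.
Let mpos : (0 : R) < m%:R. Proof. by rewrite ltr0n; lia. Qed.
Let npos : (0 : R) < n%:R. Proof. by rewrite ltr0n; lia. Qed.

Definition log_ratio : R := ln m%:R / ln n%:R.

Lemma beta_gt0 : 0 < log_ratio. Proof. by rewrite divr_gt0. Qed.

Lemma beta_lt1 : log_ratio < 1.
Proof. by rewrite ltr_pdivrMr // mul1r ltr_ln ?posrE // ltr_nat. Qed.

Lemma weak_level_ge l : l%:R <= log_ratio * (weak_level l)%:R.
Proof.
rewrite /log_ratio mulrAC ler_pdivlMr // [leRHS]mulrC !mulr_natl.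
rewrite -!lnXn // ler_ln ?posrE ?exprn_gt0 // -!natrX ler_nat.
exact: weak_levelP.
Qed.

Lemma weak_level_le l : (weak_level l)%:R * ln m%:R <= ln m%:R + l%:R * ln n%:R :> R.
Proof.
rewrite !mulr_natl -!lnXn // -lnM ?posrE ?exprn_gt0 //.
rewrite ler_ln ?posrE ?mulr_gt0 ?exprn_gt0 // -!natrX -natrM ler_nat.
exact: weak_level_upper.
Qed.

(* A function of linear growth cannot satisfy beta * f(k(l)) < f(l) - eps l along
   the orbit of l0 under k = weak_level: each step lowers f(l)/l by eps. *)
Lemma exists_good_level (f : nat -> R) (c eps : R) (l0 T : nat) :
  (forall l, 0 <= f l) -> (forall l, f l <= c * l%:R) -> c < eps * T%:R ->
  (0 < l0)%N -> exists2 t, (t < T)%N &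
    let l := iter t weak_level l0 in f l - eps * l%:R <= log_ratio * f (weak_level l).
Proof.
move=> f0 fc cT l0_gt0; apply: contrapT => bad.
have K0 t : (0 < iter t weak_level l0)%N.
  by elim: t => //= t IH; apply: leq_trans (leq_weak_level _).
suff H t : (t <= T)%N -> f (iter t weak_level l0) <= (c - eps * t%:R) * (iter t weak_level l0)%:R.
  have := f0 (iter T weak_level l0); apply/negP; rewrite -ltNge.
  by apply: le_lt_trans (H T (leqnn _)) _; rewrite nmulr_rlt0 ?ltr0n // subr_lt0.
elim: t => [|t IH] tT; first by rewrite mulr0 subr0.
set l := iter t weak_level l0 in IH *.
have afl : log_ratio * f (weak_level l) < f l - eps * l%:R.
  by rewrite ltNge; apply/negP => good; apply: bad; exists t.
have fl := IH (ltnW tT).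
have a0 := mulr_ge0 (ltW beta_gt0) (f0 (weak_level l)).
have l_gt0 : (0 : R) < l%:R by rewrite ltr0n K0.
(* The new slope is nonnegative because beta f(k(l)) is; hence [weak_level_ge] may be multiplied by
   it. *)
have ce : 0 <= c - eps * t.+1%:R.
  by rewrite -(pmulr_lge0 _ l_gt0) -natr1; lra.
rewrite /= -/l -(ler_pM2l beta_gt0) mulrCA.
apply: (@le_trans _ _ ((c - eps * t.+1%:R) * l%:R)); first by rewrite -natr1; lra.
by apply: ler_wpM2l => //; exact: weak_level_ge.
Qed.

End Levels.

Lemma sum_count_map (A : pzSemiRingType) (T : eqType) (I : finType) (f : T -> I)
    (g : I -> A) (s : seq T) :
  \sum_(x <- s) g (f x) = \sum_i (count (fun x => f x == i) s)%:R * g i.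
Proof.
transitivity (\sum_(x <- s) \sum_i (f x == i)%:R * g i).
  apply: eq_bigr => x _; rewrite (bigD1 (f x)) //= eqxx mul1r big1 ?addr0 // => i.
  by rewrite eq_sym => /negPf ->; rewrite mul0r.
rewrite exchange_big /=; apply: eq_bigr => i _; rewrite -mulr_suml; congr (_ * _).
by rewrite -sum1_count natr_sum [RHS]big_mkcond /=; apply: eq_bigr => x _; case: eqP.
Qed.

(** * Row counts and McMullen weights *)

Section RowCounts.
Context {R : realType} {m n : nat}.
Context (D : {set 'I_n * 'I_m}) (sigma eta : 'I_n * 'I_m -> bool).
Implicit Types (u v : seq ('I_n * 'I_m)) (b : seq ('I_m * bool)).

Notation row := (weak_row eta).
Notation beta := (@log_ratio R m n).

Definition row_count (w : 'I_m * bool) : nat := count (fun d => row d == w) (enum D).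

Definition row_sum : R := \sum_w (row_count w)%:R `^ beta.

Definition rows : seq ('I_m * bool) := [seq w <- enum {: 'I_m * bool} | (0 < row_count w)%N].

Lemma row_count_gt0 d : d \in D -> (0 < row_count (row d))%N.
Proof. by move=> dD; rewrite -has_count; apply/hasP; exists d; rewrite ?mem_enum. Qed.

Lemma mem_rows d : d \in D -> row d \in rows.
Proof. by move=> /row_count_gt0 dD; rewrite mem_filter dD mem_enum. Qed.

Context (hm : (2 <= m)%N) (hmn : (m < n)%N).

Let b0 : 0 < beta := beta_gt0 hm hmn.

(** Each row w consists of r_w digits of weight r_w^(beta-1), which together contribute r_w^beta. *)
Lemma sum_digit_weights :
  \sum_(d <- enum D) (row_count (row d))%:R `^ (beta - 1) = row_sum.
Proof.
rewrite (sum_count_map row (fun w => (row_count w)%:R `^ (beta - 1))).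
apply: eq_bigr => w _; rewrite -/(row_count w).
by rewrite mulr_powRB1.
Qed.

Lemma sum_row_weights : \sum_(w <- rows) (row_count w)%:R `^ beta = row_sum.
Proof.
rewrite big_filter big_mkcond /row_sum big_enum /=; apply: eq_bigr => w _.
by case: ltnP => //; rewrite leqn0 => /eqP ->; rewrite powR0 // gt_eqF.
Qed.

Lemma row_sum_ge1 d : d \in D -> 1 <= row_sum.
Proof.
move=> dD; rewrite /row_sum (bigD1 (row d)) //= -[leLHS]addr0 lerD //; last first.
  by apply: sumr_ge0 => w _; rewrite powR_ge0.
apply: (@le_trans _ _ (1 `^ beta)); first by rewrite powR1.
by apply: ge0_ler_powR; rewrite ?nnegrE ?(ltW b0) // ler1n row_count_gt0.
Qed.

Definition log_count b : R := \sum_(w <- b) ln (row_count w)%:R.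

Lemma ln_nat_ge0 (k : nat) : 0 <= ln k%:R :> R.
Proof. by case: k => [|k]; [rewrite ln0 | rewrite ln_ge0 // ler1n]. Qed.

Lemma log_count_ge0 b : 0 <= log_count b.
Proof. by apply: sumr_ge0 => w _; exact: ln_nat_ge0. Qed.

Lemma log_count_cat b b' : log_count (b ++ b') = log_count b + log_count b'.
Proof. exact: big_cat. Qed.

Lemma log_count_le b : log_count b <= ln (size (enum D))%:R * (size b)%:R.
Proof.
elim: b => [|w b IH]; first by rewrite /log_count big_nil mulr0.
rewrite /log_count big_cons /= -[X in _ * X%:R]add1n natrD mulrDr mulr1 lerD //.
case: (posnP (row_count w)) => [->|w0]; first by rewrite ln0 // ln_nat_ge0.
have := count_size (fun d => row d == w) (enum D); rewrite -/(row_count w) => wD.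
by rewrite ler_ln ?posrE ?ltr0n ?ler_nat // (leq_trans w0).
Qed.

Lemma prod_row_count_powR b (r : R) : all (fun w => 0 < row_count w)%N b ->
  \prod_(w <- b) (row_count w)%:R `^ r = expR (r * log_count b).
Proof.
move=> /allP b_gt0; rewrite /log_count mulr_sumr expR_sum; apply: eq_big_seq => w /b_gt0 w0.
by rewrite /powR gt_eqF // ltr0n.
Qed.

End RowCounts.

(** * Upper bound *)

Section UpperBound.
Context {R : realType} {m n : nat}.
Context (D : {set 'I_n * 'I_m}) (sigma eta : 'I_n * 'I_m -> bool).
Implicit Types (key : seq ('I_n * 'I_m) * seq ('I_m * bool)).

Notation row := (weak_row eta).
Notation beta := (@log_ratio R m n).
Notation row_count := (row_count D eta).
Notation rows := (rows D eta).
Notation row_sum := (@row_sum R m n D eta).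
Notation log_count := (@log_count R m n D eta).
Notation level := (@weak_level m n).

Context (hm : (2 <= m)%N) (hmn : (m < n)%N) (h : nat) (h1 : (h <= 1)%N).
Context (Dh : forall d, d \in D -> half_row h (row d)).
Context (K : set (R * R)) (hK : reflected_carpet D sigma eta K).

(* An approximate square: l digits, then the rows up to the weak level of l. *)
Definition square_keys (l : nat) :=
  [seq (a, b) | a <- words (enum D) l, b <- words rows (level l - l)].

Definition key_rows key := map row key.1 ++ key.2.

Definition key_square key : set (R * R) := [set p | in_square sigma h key.1 (key_rows key) p].

(* Unnormalised McMullen measure of the approximate square. *)
Definition key_weight key : R :=
  \prod_(d <- key.1) (row_count (row d))%:R `^ (beta - 1) *
  \prod_(w <- key.2) (row_count w)%:R `^ beta.

(** The sum factors over positions: each of the l digits and each of the remaining rows contributes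
    a factor Z. *)
Lemma sum_key_weight l : \sum_(key <- square_keys l) key_weight key = row_sum ^+ level l.
Proof.
rewrite big_allpairs_dep /= -[in RHS](subnKC (leq_weak_level hm hmn l)) exprD.
rewrite -[X in X ^+ l * _](sum_digit_weights _ _ hm hmn) -[X in _ * X ^+ _](sum_row_weights _ _ hm hmn).
rewrite -!sum_words mulr_suml; apply: eq_bigr => a _.
by rewrite mulr_sumr; apply: eq_bigr.
Qed.

Lemma mem_square_keys l key : key \in square_keys l ->
  [/\ size key.1 = l, size (key_rows key) = level l,
      all [in D] key.1 & all (fun w => 0 < row_count w)%N key.2].
Proof.
move=> /allpairsP[[a b] /= [+ + ->]]; rewrite !mem_words => /andP[/eqP sa aD] /andP[/eqP sb brows] /=.
split=> //; first by rewrite /key_rows size_cat size_map /= sa sb subnKC // leq_weak_level.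
  by apply: sub_all aD => d /=; rewrite mem_enum.
by apply: sub_all brows => w /=; rewrite mem_filter => /andP[].
Qed.

Lemma key_weightE l key : key \in square_keys l ->
  key_weight key = expR (beta * log_count (key_rows key) - log_count (map row key.1)).
Proof.
move=> /mem_square_keys[_ _ aD b0]; rewrite /key_weight prod_row_count_powR //.
have := @prod_row_count_powR R _ _ D eta (map row key.1) (beta - 1).
rewrite big_map => ->; last first.
  by rewrite all_map; apply: sub_all aD => d /row_count_gt0 /=; apply.
rewrite -expRD; congr expR; rewrite log_count_cat.
by ring.
Qed.

(** Logarithmic form of [key_weight key >= expR (- (eps * l))], by [key_weightE]. *)
Definition good_key (eps : R) (l : nat) key :=
  log_count (map row key.1) - eps * l%:R <= beta * log_count (key_rows key).

(** Markov's inequality: every good key weighs at least e^(-eps l), while all weights are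
    nonnegative and add up to Z^k. *)
Lemma count_good_key eps l :
  (size [seq key <- square_keys l | good_key eps l key])%:R <= row_sum ^+ level l * expR (eps * l%:R).
Proof.
rewrite -ler_pdivrMr ?expR_gt0 // -expRN -sum_key_weight.
rewrite (bigID (good_key eps l)) /= -[leLHS]addr0 lerD //; last first.
  by rewrite big_seq_cond; apply: sumr_ge0 => key /andP[/key_weightE -> _]; exact: expR_ge0.
rewrite -big_filter -sum1_size natr_sum mulr_suml big_seq [leRHS]big_seq.
apply: ler_sum => key; rewrite mem_filter => /andP[good /key_weightE ->].
by rewrite mul1r ler_expR; move: good; rewrite /good_key; lra.
Qed.

(** Both sides of the rectangle are at most n^-l, the vertical one by the choice of the weak level;
    2 is a crude bound for sqrt 2. *)
Lemma ediam_key_square l key : key \in square_keys l ->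
  (ediam (key_square key) <= (2 * n%:R ^- l)%:E)%E.
Proof.
move=> /mem_square_keys[sa sb _ _].
have n0 : (0 : R) < n%:R by rewrite ltr0n; lia.
have m0 : (0 : R) < m%:R by rewrite ltr0n; lia.
have nl : (0 : R) < n%:R ^- l by rewrite invr_gt0 exprn_gt0.
have cell (L c : nat) (s t : R) : (n ^ l <= L)%N -> in_cell L c s -> in_cell L c t ->
    `|s - t| <= n%:R ^- l.
  move=> nL; have L0 : (0 : R) < L%:R by rewrite ltr0n; apply: leq_trans nL; rewrite expn_gt0; lia.
  have : (L%:R : R)^-1 <= n%:R ^- l by rewrite lef_pV2 ?posrE ?exprn_gt0 // -natrX ler_nat.
  by rewrite /in_cell -[c.+1]addn1 natrD mulrDl mul1r ler_norml => ? /andP[? ?] /andP[? ?]; lra.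
apply: ediam_le => [|p q [p1 p2] [q1 q2]]; first by rewrite mulr_ge0 ?ltW.
have nk : (n ^ l <= 2 * m ^ size (key_rows key))%N.
  by rewrite sb (leq_trans (weak_levelP hm l)) // leq_pmull.
have nl1 : (n ^ l <= n ^ size key.1)%N by rewrite sa.
have d1 := cell _ _ _ _ nl1 p1 q1; have d2 := cell _ _ _ _ nk p2 q2.
have x0 : 0 <= 2 * n%:R ^- l :> R by rewrite mulr_ge0 ?ltW.
rewrite /euclid_dist -(ger0_norm x0) -sqrtr_sqr ler_wsqrtr // exprMn.
have sq (a : R) : `|a| <= n%:R ^- l -> a ^+ 2 <= (n%:R ^- l) ^+ 2.
  by move=> an; rewrite -real_normK ?num_real // lerXn2r ?nnegrE // ltW.
have := sq _ d1; have := sq _ d2; have := sqr_ge0 (n%:R ^- l : R); lra.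
Qed.

Lemma leq_iter_level (l0 t t' : nat) : (t <= t')%N -> (iter t level l0 <= iter t' level l0)%N.
Proof.
move=> /subnK <-; elim: (t' - t)%N => //= i IH.
exact: leq_trans IH (leq_weak_level hm hmn _).
Qed.

Lemma carpet_covered (eps : R) (T l0 : nat) q :
  ln (size (enum D))%:R < eps * T%:R -> (0 < l0)%N -> K q ->
  exists t key, [/\ (t < T)%N, key \in square_keys (iter t level l0),
    good_key eps (iter t level l0) key & key_square key q].
Proof.
move=> cT l0_gt0 Kq.
have [v [+ [q' Kq' qE]]] := word_map_in hK (iter T level l0) Kq.
rewrite mem_words => /andP[/eqP sv vD].
have {}vD : all [in D] v by apply: sub_all vD => d /=; rewrite mem_enum.
(* Here f(l) is the sum of ln r_w over the first l rows of a coding of q. The coding is long enough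
   to contain the weak levels of all T candidates. *)
have [] := @exists_good_level R m n hm hmn (fun l => log_count (map row (take l v)))
  (ln (size (enum D))%:R) eps l0 T _ _ cT l0_gt0.
- by move=> l; exact: log_count_ge0.
- move=> l; apply: le_trans (log_count_le _ _ _) _; rewrite size_map.
  by rewrite ler_wpM2l ?ln_nat_ge0 // ler_nat size_take; case: ltnP.
move=> t tT; set l := iter t level l0 => good.
have lk : (l <= level l)%N := leq_weak_level hm hmn l.
have kv : (level l <= size v)%N by rewrite sv; exact: (leq_iter_level l0 tT).
pose key := (take l v, map row (drop l (take (level l) v))).
have keyE : key_rows key = map row (take (level l) v).
  by rewrite /key_rows /= -map_cat -{1}(take_takel v lk) cat_take_drop.
exists t, key; split => //.
- apply/allpairsP; exists key; split => //; rewrite mem_words.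
    rewrite size_takel ?(leq_trans lk) // eqxx /=; apply/allP => d /mem_take dv /=.
    by rewrite mem_enum; exact: (allP vD).
  rewrite size_map size_drop size_takel // eqxx /=; apply/allP => w /mapP[d /mem_drop/mem_take dv ->] /=.
  by apply: mem_rows; exact: (allP vD).
- by rewrite /good_key keyE.
by rewrite /key_square /= keyE qE; exact: (in_square_word_map hm hmn h1 Dh hK).
Qed.

Lemma hausdorff_measure_upper s : ln row_sum / ln m%:R < s -> hausdorff_measure s K = 0%E.
Proof.
move=> gs.
have [d0 d0D] : exists d, d \in D.
  by case: (hK) => -[q Kq] _ _; have [d dD _] := carpet_in hK Kq; exists d.
have Z1 : 1 <= row_sum := @row_sum_ge1 R _ _ _ eta hm hmn _ d0D.
have Z0 : 0 < row_sum := lt_le_trans ltr01 Z1.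
have lnm : 0 < ln m%:R :> R by rewrite ln_gt0 // ltr1n.
have lnn : 0 < ln n%:R :> R by rewrite ln_gt0 // ltr1n; lia.
have n1 : (1 < n)%N by lia.
have npos : (0 : R) < n%:R by rewrite ltr0n ltnW.
have lnZ : 0 <= ln row_sum / ln m%:R :> R by apply: divr_ge0; [exact: ln_ge0 | exact: ltW].
have s0 : 0 < s := le_lt_trans lnZ gs.
(* With gamma = ln Z / ln m, this makes Z^k n^(-s l) at most Z e^(-2 eps l), so a factor e^(-eps l)
   survives the e^(eps l) in the count of good keys. *)
pose eps := (s - ln row_sum / ln m%:R) * ln n%:R / 2.
have eps0 : 0 < eps by rewrite !mulr_gt0 // subr_gt0.
have [T cT] : exists T : nat, ln (size (enum D))%:R < eps * T%:R.
  exists (Num.trunc (ln (size (enum D))%:R / eps)).+1.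
  by rewrite mulrC -ltr_pdivrMr // truncnS_gt.
apply: (hausdorff_measure_eq0 s0) => delta e delta0 e0.
pose C := 2 `^ s * row_sum.
have C0 : 0 < C by rewrite mulr_gt0 ?powR_gt0.
(* The first summand makes the diameters at most delta; the second makes T C e^(-eps l0) at most e,
   through x <= e^x. *)
have [l0 l0_gt0 l0E] : exists2 l0, (0 < l0)%N & 2 / delta + T%:R * C / (eps * e) < l0%:R.
  by exists (Num.trunc (2 / delta + T%:R * C / (eps * e))).+1; rewrite ?truncnS_gt.
have Tx0 : 0 <= T%:R * C / (eps * e) by apply: divr_ge0; apply: mulr_ge0 => //; exact: ltW.
have ll0 t : (l0 <= iter t level l0)%N := leq_iter_level l0 (leq0n t).
exists [seq (key_square key, 2 * n%:R ^- iter t level l0) |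
  t <- iota 0 T, key <- [seq key <- square_keys (iter t level l0) | good_key eps (iter t level l0) key]].
split.
- move=> q Kq; have [t [key [tT keyl good keyq]]] := carpet_covered cT l0_gt0 Kq.
  exists (key_square key, 2 * n%:R ^- iter t level l0) => //.
  apply/allpairsPdep; exists t, key; split => //; first by rewrite mem_iota.
  by rewrite mem_filter good.
- move=> U /allpairsPdep[t [key [_ + ->]]] /=; rewrite mem_filter => /andP[_ keyl].
  split; last exact: ediam_key_square.
  have nl0 : (0 : R) < n%:R ^+ iter t level l0 by rewrite exprn_gt0.
  rewrite mulr_ge0 ?invr_ge0 ?(ltW nl0) //= ler_pdivrMr // -ler_pdivrMl // mulrC.
  apply: (@le_trans _ _ l0%:R); first by lra.
  by rewrite -natrX ler_nat; apply: (leq_trans (ll0 t)); apply: ltnW; exact: ltn_expl.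
rewrite big_allpairs_dep /=.
(* Each of the T levels contributes at most C e^(-eps l0). The factor Z in C pays for the rounding
   m^k <= m n^l of the weak level. *)
apply: (@le_trans _ _ (\sum_(t <- iota 0 T) C * expR (- (eps * l0%:R)))).
  apply: ler_sum => t _; rewrite big_const_seq count_predT iter_addr_0 -[leLHS]mulr_natl.
  set l := iter t level l0.
  apply: le_trans (ler_wpM2r (powR_ge0 _ _) (count_good_key _ _)) _.
  have -> : row_sum ^+ level l = expR ((level l)%:R * ln row_sum).
    by rewrite expRM_natl lnK.
  have -> : (2 * n%:R ^- l) `^ s = 2 `^ s * expR (- s * (l%:R * ln n%:R)).
    rewrite powRM ?invr_ge0 ?exprn_ge0 ?ltW // -powR_invn ?ltW // -powRrM.
    by rewrite {2}/powR gt_eqF //; congr (_ * expR _); ring.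
  rewrite mulrCA -expRD -expRD /C -mulrA ler_pM2l ?powR_gt0 //.
  rewrite -{2}(lnK Z0) -expRD ler_expR.
  have ll : (l0%:R : R) <= l%:R by rewrite ler_nat; exact: ll0.
  have kl := @weak_level_le R m n hm hmn l.
  have := ler_wpM2l lnZ kl; have := ler_wpM2l (ltW eps0) ll.
  have -> : ln row_sum / ln m%:R * ((level l)%:R * ln m%:R) = (level l)%:R * ln row_sum :> R.
    by field; rewrite gt_eqF.
  have -> : ln row_sum / ln m%:R * (ln m%:R + l%:R * ln n%:R) =
      ln row_sum + l%:R * (s * ln n%:R - 2 * eps) :> R.
    by rewrite /eps; field; rewrite gt_eqF.
  by move=> e1 e2; lra.
rewrite big_const_seq count_predT size_iota iter_addr_0 -[leLHS]mulr_natl mulrA.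
rewrite expRN ler_pdivrMr ?expR_gt0 //.
have el0 : eps * l0%:R <= expR (eps * l0%:R).
  by apply: le_trans (expR_ge1Dx _); rewrite lerDr.
apply: le_trans (ler_wpM2l (ltW e0) el0).
have : T%:R * C / (eps * e) <= l0%:R by have := divr_gt0 (ltr0Sn R 1) delta0; lra.
by rewrite ler_pdivrMr ?mulr_gt0 //; lra.
Qed.

End UpperBound.

(** * Lower bound *)

Lemma poly_le_exp (R : realType) (x : R) (k : nat) : 1 < x ->
  exists2 N, (0 < N)%N & (N.+1)%:R ^+ k <= x ^+ N.
Proof.
move=> x1; have lnx : 0 < ln x by rewrite ln_gt0.
(* Then x = e^(2 t (k+1)), and N + 1 <= (1 + N t)^2 <= e^(2 N t) as soon as N t^2 >= 1. Using k + 1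
   keeps the denominator positive when k = 0. *)
pose t := ln x / (2 * k.+1%:R).
have t0 : 0 < t by rewrite divr_gt0 // mulr_gt0.
have [N Nt] : exists N : nat, (t ^+ 2)^-1 < N%:R.
  by exists (Num.trunc (t ^+ 2)^-1).+1; rewrite truncnS_gt.
have N0 : (0 < N)%N by rewrite -(ltr0n R); apply: lt_trans Nt; rewrite invr_gt0 exprn_gt0.
exists N => //.
have Nt1 : 1 <= N%:R * t ^+ 2 by rewrite -ler_pdivrMr ?exprn_gt0 // mul1r ltW.
have NR : (0 : R) < N%:R by rewrite ltr0n.
have sq : N.+1%:R <= expR (N%:R * t) ^+ 2.
  apply: (@le_trans _ _ ((1 + N%:R * t) ^+ 2)).
    have Nt0 : 0 <= N%:R * t by rewrite mulr_ge0 ?ltW.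
    have : N%:R <= N%:R * (N%:R * t ^+ 2) by apply: ler_peMr => //; exact: ltW.
    by rewrite -natr1 sqrrD exprMn expr2 expr1n; nra.
  by rewrite lerXn2r ?nnegrE ?expR_ge1Dx ?expR_ge0 // addr_ge0 // mulr_ge0 ?ltW.
have -> : x ^+ N = (expR (N%:R * t) ^+ 2) ^+ k.+1.
  rewrite -exprM -expRM_natl -{1}(lnK (x := x)) ?posrE ?(lt_trans ltr01) // -expRM_natl.
  by congr expR; rewrite /t natrM; field.
apply: (@le_trans _ _ (N.+1%:R ^+ k.+1)); first by apply: ler_weXn2l; rewrite ?ler1n.
by rewrite lerXn2r ?nnegrE ?exprn_ge0 ?expR_ge0.
Qed.

Lemma pigeonhole_sum (R : realType) (T : eqType) (I : finType) (f : T -> I) (W : T -> R)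
    (s : seq T) : (0 < #|I|)%N ->
  exists i, \sum_(x <- s) W x <= #|I|%:R * \sum_(x <- s | f x == i) W x.
Proof.
move=> I0; apply: contrapT => no.
have lt i : \sum_(x <- s | f x == i) W x < (\sum_(x <- s) W x) / #|I|%:R.
  rewrite ltr_pdivlMr ?ltr0n // mulrC ltNge; apply/negP => le; apply: no.
  by exists i.
have [i0 _] : exists i : I, true by case/card_gt0P: I0 => i _; exists i.
have : \sum_i \sum_(x <- s | f x == i) W x < \sum_(i : I) (\sum_(x <- s) W x) / #|I|%:R.
  by apply: ltr_sum => //; apply/hasP; exists i0; rewrite ?mem_index_enum.
rewrite sumr_const -[_ *+ _]mulr_natr divfK ?pnatr_eq0 -?lt0n //.
suff -> : \sum_i \sum_(x <- s | f x == i) W x = \sum_(x <- s) W x by rewrite ltxx.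
under eq_bigr do rewrite big_mkcond.
rewrite exchange_big /=; apply: eq_bigr => x _.
by rewrite (bigD1 (f x)) //= eqxx big1 ?addr0 // => i /negPf; rewrite eq_sym => ->.
Qed.

(** * Blocks with fibres of equal size, by the method of types *)

Section Blocks.
Context {R : realType} {m n : nat}.
Context (D : {set 'I_n * 'I_m}) (sigma eta : 'I_n * 'I_m -> bool).
Implicit Types (u v : seq ('I_n * 'I_m)) (b : seq ('I_m * bool)).

Notation row := (weak_row eta).
Notation beta := (@log_ratio R m n).
Notation row_count := (row_count D eta).
Notation row_sum := (@row_sum R m n D eta).

Context (hm : (2 <= m)%N) (hmn : (m < n)%N).

(** For words of length N the occurrence numbers are at most N, so [inord] does not alter them. *)
Definition word_type (N : nat) u : {ffun 'I_m * bool -> 'I_N.+1} :=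
  [ffun w => inord (count_mem w (map row u))].

Definition fibre_size b := (\prod_(w <- b) row_count w)%N.

Lemma word_type_perm N u v : size u = N -> size v = N -> word_type N u = word_type N v ->
  perm_eq (map row u) (map row v).
Proof.
move=> su sv /ffunP uv; apply/allP => w _ /=.
have := congr1 val (uv w); rewrite !ffunE /= !inordK ?ltnS; first by move=> ->.
  by rewrite -sv -(size_map row v) count_size.
by rewrite -su -(size_map row u) count_size.
Qed.

Lemma count_fibre u : all [in D] u ->
  count (fun v => map row v == map row u) (words (enum D) (size u)) = fibre_size (map row u).
Proof. by move=> uD; rewrite count_map_words ?size_map. Qed.

Lemma prod_digit_weight u : all [in D] u ->
  \prod_(d <- u) (row_count (row d))%:R `^ (beta - 1) = (fibre_size (map row u))%:R `^ (beta - 1).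
Proof.
elim: u => [|d u IH] /=; first by rewrite /fibre_size !big_nil powR1.
by move=> /andP[dD uD]; rewrite /fibre_size !big_cons IH // natrM powRM.
Qed.

(* The words of length N with a prescribed number of occurrences of each row
   form a subsystem all of whose fibres have the same size r. *)
Lemma exists_uniform_blocks (s : R) : (exists d, d \in D) -> s * ln m%:R < ln row_sum ->
  exists N r (G : seq (seq ('I_n * 'I_m))),
    [/\ (0 < N)%N, uniq G /\ {subset G <= words (enum D) N},
        (0 < r <= size G)%N, forall b, (count (fun u => map row u == b) G <= r)%N &
        s * (N%:R * ln m%:R) <= ln (size G)%:R + (beta - 1) * ln r%:R].
Proof.
move=> [d0 d0D] sZ.
have Z0 : 0 < row_sum by apply: lt_le_trans ltr01 (@row_sum_ge1 R _ _ D eta hm hmn d0 d0D).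
(* There are (N+1)^(2m) possible types, one exponent for each of the 2m rows; N is taken so large
   that (Z / m^s)^N exceeds this number. *)
have [N N0 polyN] := @poly_le_exp R (expR (ln row_sum - s * ln m%:R)) (m * 2)
  ltac:(by rewrite expR_gt1 subr_gt0).
pose I := {ffun 'I_m * bool -> 'I_N.+1}.
have cI : #|{: I}| = (N.+1 ^ (m * 2))%N by rewrite card_ffun card_ord card_prod card_ord card_bool.
(* The weights of all words of length N add up to Z^N, so some type carries at least the fraction
   (N+1)^(-2m) of it. *)
have [|t] := @pigeonhole_sum R _ I (word_type N)
  (fun u => \prod_(d <- u) (row_count (row d))%:R `^ (beta - 1)) (words (enum D) N).
  by rewrite cI expn_gt0.
rewrite sum_words (sum_digit_weights _ _ hm hmn) cI => ZN.
pose G := [seq u <- words (enum D) N | word_type N u == t].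
have GP u : u \in G -> [/\ size u = N, all [in D] u & word_type N u = t].
  rewrite mem_filter mem_words => /andP[/eqP ut /andP[/eqP su uD]]; split => //.
  by apply: sub_all uD => d /=; rewrite mem_enum.
have [u0 u0G] : exists u, u \in G.
  case: (posnP (size G)) => [/size0nil G0|G0]; last by exists (nth [::] G 0); rewrite mem_nth.
  by move: ZN; rewrite -big_filter -/G G0 big_nil mulr0 leNgt exprn_gt0.
have [su0 u0D ut0] := GP _ u0G.
pose r := fibre_size (map row u0).
have rG u : u \in G -> fibre_size (map row u) = r.
  move=> /GP[su uD ut]; apply: perm_big; apply: (@word_type_perm N) => //.
  by rewrite ut.
have r0 : (0 < r)%N.
  rewrite /r /fibre_size big_map big_seq; apply: prodn_cond_gt0 => d du.
  by apply: row_count_gt0; apply: (allP u0D).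
(* The type depends only on the row word, so [G] contains the whole fibre of [u0]. *)
have rsize : (r <= size G)%N.
  rewrite /r -count_fibre // su0 size_filter; apply: sub_count => u /eqP uu0.
  by rewrite -ut0; apply/eqP/ffunP => w; rewrite !ffunE uu0.
exists N, r, G; split => //.
- split; last by move=> u; rewrite mem_filter => /andP[].
  by rewrite filter_uniq // uniq_words // enum_uniq.
- by rewrite r0.
- move=> b; case: (posnP (count (fun u => map row u == b) G)) => [->//|].
  rewrite -has_count => /hasP[u uG /eqP ub]; rewrite -(rG _ uG).
  have [su uD _] := GP _ uG; rewrite -count_fibre // su -ub.
  by rewrite /G count_filter; apply: sub_count => v /andP[].
have GR : 0 < (size G)%:R :> R by rewrite ltr0n (leq_trans r0).
have rR : 0 < r%:R :> R by rewrite ltr0n.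
have {}ZN : row_sum ^+ N <= (N.+1 ^ (m * 2))%:R * ((size G)%:R * r%:R `^ (beta - 1)).
  apply: le_trans ZN _; rewrite ler_wpM2l // -big_filter -/G -sum1_size natr_sum mulr_suml.
  rewrite big_seq [leRHS]big_seq; apply: ler_sum => u uG; have [_ uD _] := GP _ uG.
  by rewrite mul1r prod_digit_weight // rG.
have : row_sum ^+ N <= expR (ln row_sum - s * ln m%:R) ^+ N * ((size G)%:R * r%:R `^ (beta - 1)).
  by apply: le_trans ZN _; rewrite ler_wpM2r ?mulr_ge0 ?powR_ge0 // natrX.
rewrite -ler_ln ?posrE ?mulr_gt0 ?exprn_gt0 ?expR_gt0 ?powR_gt0 //.
rewrite lnM ?posrE ?mulr_gt0 ?exprn_gt0 ?expR_gt0 ?powR_gt0 //.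
rewrite lnM ?posrE ?powR_gt0 // ln_powR !lnXn ?expR_gt0 // expRK.
rewrite -[ln row_sum *+ N]mulr_natl -[(ln row_sum - _) *+ N]mulr_natl; lra.
Qed.

End Blocks.

Lemma open_box (R : realType) (x : R * R) (r : R) : open (box x r).
Proof.
suff -> : box x r = ball x r by exact: ball_open.
rewrite -ball_normE; apply/seteqP; split => p; rewrite /box /ball_ /= prod_normE gt_max /=.
  by move=> [h1 h2]; rewrite distrC h1 distrC h2.
by move=> /andP[h1 h2]; rewrite distrC h1 distrC h2.
Qed.

Lemma compact_boxes (R : realType) (K : set (R * R)) (x : nat -> R * R) (r : nat -> R) :
  compact K -> K `<=` \bigcup_k box (x k) (r k) ->
  exists N0 : nat, forall p, K p -> exists2 k, (k < N0)%N & box (x k) (r k) p.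
Proof.
move=> /compact_near_coveringP Kc Kx.
have [|N0 _ KN] := Kc nat \oo (fun N p => exists2 k, (k < N)%N & box (x k) (r k) p).
  move=> p /Kx[k _ pk]; exists (box (x k) (r k), [set N | (k < N)%N]).
    split => /=; last by exists k.+1.
    by apply: open_nbhs_nbhs; split => //; exact: open_box.
  by move=> [p' N] [/= pk' kN]; exists k.
by exists N0 => p; exact: (KN N0 (leqnn N0)).
Qed.

(** The chain c <= t L < (t' + 2r) L <= c' + 1 + C is strict, which absorbs the extra 1. *)
Lemma in_cell_close (R : realType) (L c c' C : nat) (t t' x r : R) : (0 < L)%N ->
  in_cell L c t -> in_cell L c' t' -> `|t - x| < r -> `|t' - x| < r ->
  2 * r * L%:R <= C%:R -> (c <= c' + C)%N.
Proof.
move=> L0; have LR : (0 : R) < L%:R by rewrite ltr0n.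
rewrite /in_cell !ler_pdivrMr // !ler_pdivlMr // => /andP[a1 _] /andP[_ a2].
rewrite !ltr_norml => /andP[_ b1] /andP[b2 _] rC.
have : t * L%:R < (t' + 2 * r) * L%:R by rewrite ltr_pM2r //; lra.
rewrite mulrDl => tt; rewrite -ltnS -addnS -(ltr_nat R) natrD -natr1.
by rewrite -natr1 in a2; lra.
Qed.

Lemma exists_level (R : realType) (n : nat) (r : R) : (2 <= n)%N -> 0 < r -> r < 1 ->
  exists l, n%:R ^- l.+1 <= r /\ r < n%:R ^- l.
Proof.
move=> n2 r0 r1.
have n0 : (0 : R) < n%:R by rewrite ltr0n ltnW.
have ex : exists l, (n%:R : R) ^- l.+1 <= r.
  exists (Num.trunc r^-1); rewrite -[leRHS]invrK lef_pV2 ?posrE ?invr_gt0 ?exprn_gt0 //.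
  apply: (@le_trans _ _ (Num.trunc r^-1).+1%:R); first by rewrite ltW // truncnS_gt.
  by rewrite -natrX ler_nat ltnW // ltn_expl.
case: (ex_minnP ex) => -[|l] hl minl; [exists 0 | exists l.+1]; split => //.
  by rewrite expr0 invr1.
by rewrite ltNge; apply/negP => /minl; rewrite ltnn.
Qed.

Lemma all_flatten_words (T : eqType) (s : seq T) (H : seq (seq T)) L B (v : seq (seq T)) :
  {subset H <= words s L} -> v \in words H B ->
  [/\ size v = B, shape v = nseq B L & all [in s] (flatten v)].
Proof.
move=> Hs; elim: B v => [|B IH] [|u v]; rewrite mem_words //= => /andP[].
rewrite eqSS => sv /andP[/Hs uH vH].
have [] := IH v; first by rewrite mem_words sv.
move=> -> -> vs; move: uH; rewrite mem_words => /andP[/eqP -> us]; split=> //.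
by rewrite all_cat us.
Qed.

Lemma take_flatten_words (T : eqType) (s : seq T) (H : seq (seq T)) L B (v : seq (seq T)) k :
  {subset H <= words s L} -> v \in words H B -> (k <= B)%N ->
  take (k * L) (flatten v) = flatten (take k v) /\ size (flatten (take k v)) = (k * L)%N.
Proof.
move=> Hs; elim: B v k => [|B IH] [|u v] [|k]; rewrite mem_words ?mul0n ?take0 //= => /andP[].
rewrite eqSS => sv /andP[/Hs + vH]; rewrite mem_words => /andP[/eqP su _] kB.
have [] := IH v k; rewrite ?mem_words ?sv // => e1 e2.
rewrite mulSn size_cat su e2; split => //.
by rewrite take_cat su ltnNge leq_addr /= addKn e1.
Qed.

(** The differences from c lie in [-C, C]; adding C makes them natural numbers below 2C + 1, where
    neither subtraction nor [inord] truncates. *)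
Lemma shifted_inord_inj (C a b c : nat) : (a <= c + C)%N -> (c <= a + C)%N ->
  (b <= c + C)%N -> (c <= b + C)%N ->
  inord (a + C - c) = inord (b + C - c) :> 'I_(2 * C).+1 -> a = b.
Proof. by move=> ? ? ? ? /(congr1 val) /=; rewrite !inordK; lia. Qed.

(** * Mass distribution on concatenated blocks *)

Section LowerBound.
Context {R : realType} {m n : nat}.
Context (D : {set 'I_n * 'I_m}) (sigma eta : 'I_n * 'I_m -> bool).
Implicit Types (v : seq (seq ('I_n * 'I_m))).

Notation row := (weak_row eta).
Notation beta := (@log_ratio R m n).
Notation row_count := (row_count D eta).
Notation row_sum := (@row_sum R m n D eta).

Context (hm : (2 <= m)%N) (hmn : (m < n)%N) (h : nat) (h1 : (h <= 1)%N).
Context (Dh : forall d, d \in D -> half_row h (row d)).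
Context (K : set (R * R)) (hK : reflected_carpet D sigma eta K).
Context (N r : nat) (G : seq (seq ('I_n * 'I_m))) (N0 : (0 < N)%N).
Context (uniqG : uniq G) (GD : {subset G <= words (enum D) N}).
Context (rG : forall b, (count (fun u => map row u == b) G <= r)%N).

(** Levels count blocks of N letters, which amounts to replacing m and n by m^N and n^N. *)
Notation level := (@weak_level (m ^ N) (n ^ N)).

Let n0 : (0 < n)%N. Proof. lia. Qed.
Let m0 : (0 < m)%N. Proof. lia. Qed.
Let mN : (2 <= m ^ N)%N. Proof. by rewrite (leq_trans hm) // -{1}(expn1 m) leq_exp2l. Qed.
Let mnN : (m ^ N < n ^ N)%N. Proof. by rewrite ltn_exp2r. Qed.

(** All points in the box have codes within C of those of one fixed word, leaving (2C+1)^2 pairs of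
    codes. Each pair fixes the first l blocks and the rows of the first k blocks, and
    [count_class_words] bounds the words that remain. *)
Lemma count_blocks_in_box (l B : nat) (x q : R * R) (e : R) :
  K q -> 0 < e -> e < (n ^ N)%:R ^- l -> (level l <= B)%N ->
  (count (fun v => `[< box x e (word_map sigma eta (flatten v) q) >]) (words G B) <=
   (2 * (4 * m ^ N)).+1 ^ 2 * (r ^ (level l - l) * size G ^ (B - level l)))%N.
Proof.
move=> Kq e0 el kB.
set k := level l in kB *; set C := (4 * m ^ N)%N.
have lk : (l <= k)%N := leq_weak_level mN mnN l.
set inbox := fun v => _; set X := [seq v <- words G B | inbox v].
rewrite -size_filter -/X.
case: (posnP (size X)) => [->//|X0].
have {X0}[v0 v0X] : exists v, v \in X by exists (nth [::] X 0); rewrite mem_nth.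
pose cx v := strong_code sigma (take (l * N) (flatten v)).
pose cy v := weak_code h (map row (take (k * N) (flatten v))).
have inD v : v \in words G B -> all [in D] (flatten v).
  move=> /(all_flatten_words GD)[_ _]; apply: sub_all => d /=; by rewrite mem_enum.
have szl v : v \in words G B -> size (take (l * N) (flatten v)) = (l * N)%N.
  by move=> vW; have [-> ->] := take_flatten_words GD vW (leq_trans lk kB).
have szk v : v \in words G B -> size (map row (take (k * N) (flatten v))) = (k * N)%N.
  by move=> vW; rewrite size_map; have [-> ->] := take_flatten_words GD vW kB.
have nl0 : (0 : R) < (n ^ N)%:R ^+ l by rewrite exprn_gt0 // ltr0n expn_gt0 n0.
have eN : e * (n ^ (l * N))%:R < 1.
  by rewrite mulnC expnM natrX -ltr_pdivlMr // mul1r.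
(* The weak level satisfies m^(N k) <= m^N n^(N l), and e n^(N l) < 1; hence the constant 4 m^N. *)
have eM : 2 * e * (2 * m ^ (k * N))%:R <= C%:R.
  have := weak_level_upper mN mnN l; rewrite -/k -(ler_nat R).
  move: eN; rewrite /C [(l * N)%N]mulnC [(k * N)%N]mulnC !expnM !natrM.
  move: ((n ^ N) ^ l)%:R ((m ^ N) ^ k)%:R (m ^ N)%:R (ler0n R (m ^ N)) => a b c c0 ea bc.
  have := ler_wpM2l (ltW e0) bc; have := ler_wpM2l c0 (ltW ea); lra.
have close v v' : v \in X -> v' \in X -> (cx v <= cx v' + C)%N /\ (cy v <= cy v' + C)%N.
  rewrite !mem_filter => /andP[/asboolP[bx by_] vW] /andP[/asboolP[bx' by'] vW'].
  have [ax ay] := in_square_word_map hm hmn h1 Dh hK (l * N) (k * N) (inD _ vW) Kq.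
  have [ax' ay'] := in_square_word_map hm hmn h1 Dh hK (l * N) (k * N) (inD _ vW') Kq.
  rewrite szl // szl // in ax ax'; rewrite szk // szk // in ay ay'.
  split.
    apply: (in_cell_close _ ax ax' bx bx'); first by rewrite expn_gt0 n0.
    have m'1 : (1 : R) <= (m ^ N)%:R by rewrite ler1n ltnW.
    by rewrite /C natrM; lra.
  apply: (in_cell_close _ ay ay' by_ by' eM).
  by rewrite muln_gt0 expn_gt0 m0.
pose f v : 'I_(2 * (4 * m ^ N)).+1 * 'I_(2 * (4 * m ^ N)).+1 :=
  (inord (cx v + C - cx v0), inord (cy v + C - cy v0)).
have -> : ((2 * (4 * m ^ N)).+1 ^ 2)%N = #|{: 'I_(2 * (4 * m ^ N)).+1 * 'I_(2 * (4 * m ^ N)).+1}|.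
  by rewrite card_prod card_ord expnS expn1.
apply: (@leq_size_fibres _ _ f) => i.
case: (posnP (count (fun v => f v == i) X)) => [->//|].
rewrite -has_count => /hasP[v1 v1X /eqP fv1].
have v1W : v1 \in words G B by move: v1X; rewrite mem_filter => /andP[].
have [sv1 _ _] := all_flatten_words GD v1W.
have lkB : (l <= k <= B)%N by rewrite lk kB.
apply: leq_trans (count_class_words uniqG rG sv1 lkB).
rewrite count_filter -!size_filter; apply: uniq_leq_size.
  by rewrite filter_uniq // uniq_words.
move=> v; rewrite !mem_filter => /andP[/andP[/eqP fv vb] vW]; rewrite vW andbT.
have vX : v \in X by rewrite mem_filter vb.
move: fv; rewrite -fv1 => -[ex ey].
have [c1 c2] := close _ _ vX v0X; have [c3 c4] := close _ _ v0X vX.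
have [c1' c2'] := close _ _ v1X v0X; have [c3' c4'] := close _ _ v0X v1X.
have {}ex : cx v = cx v1 := shifted_inord_inj c1 c3 c1' c3' ex.
have {}ey : cy v = cy v1 := shifted_inord_inj c2 c4 c2' c4' ey.
have half v' : v' \in words G B -> all (half_row h) (map row (take (k * N) (flatten v'))).
  move=> /inD /allP v'D; rewrite all_map; apply/allP => d /mem_take dv /=.
  by apply: Dh; exact: v'D.
(* The weak codes fix the rows first; only then do the strong codes determine the digits. *)
have rows_eq : map row (take (k * N) (flatten v)) = map row (take (k * N) (flatten v1)).
  by apply: (weak_code_inj h1 _ _ _ ey); rewrite ?half // !szk.
(* All blocks have length N, so equal concatenations are equal block by block. *)
have shapeE (A A' : eqType) (g : A -> A') (w : seq (seq A)) : shape (map (map g) w) = shape w.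
  by rewrite /shape -map_comp; apply: eq_map => x'; rewrite /= size_map.
have [_ shv _] := all_flatten_words GD vW; have [_ shv1 _] := all_flatten_words GD v1W.
apply/andP; split; apply/eqP.
  have lkN : (l * N <= k * N)%N by rewrite leq_mul2r lk orbT.
  apply: eq_from_flatten_shape; last by rewrite /shape !map_take -!/(shape _) shv shv1.
  have [<- _] := take_flatten_words GD vW (leq_trans lk kB).
  have [<- _] := take_flatten_words GD v1W (leq_trans lk kB).
  apply: (@strong_code_inj _ _ sigma eta) ex; have := congr1 (take (l * N)) rows_eq.
  by rewrite -!map_take !(take_takel _ lkN).
apply: eq_from_flatten_shape; last by rewrite !shapeE /shape !map_take -!/(shape _) shv shv1.
rewrite -!map_flatten; have [<- _] := take_flatten_words GD vW kB.
by have [<- _] := take_flatten_words GD v1W kB.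
Qed.

(** For g = ln #G and a = ln r this is the logarithm of r^(k-l) n^(s N l) <= #G^k. Multiplied by
    beta, the left side is at most beta k a + l (g - a) by the hypothesis on s, and l <= beta k with
    a <= g concludes. *)
Lemma block_exponent (s g a : R) (l k : nat) : 0 <= a -> a <= g ->
  s * (N%:R * ln m%:R) <= g + (beta - 1) * a -> l%:R * ln n%:R <= k%:R * ln m%:R :> R ->
  (l <= k)%N -> (k - l)%:R * a + s * (l%:R * (N%:R * ln n%:R)) <= k%:R * g.
Proof.
move=> a0 ag sN lnk lk.
have lnm : 0 < ln m%:R :> R by rewrite ln_gt0 // ltr1n.
have lnn : 0 < ln n%:R :> R by rewrite ln_gt0 // ltr1n (ltn_trans hm hmn).
have b0 : 0 < beta := beta_gt0 hm hmn.
have bE : ln m%:R = beta * ln n%:R :> R by rewrite divfK // gt_eqF.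
rewrite natrB // -(ler_pM2l b0).
have lk' : l%:R <= beta * k%:R :> R by rewrite -(ler_pM2r lnn) mulrAC -bE [leRHS]mulrC.
have := ler_wpM2r (_ : 0 <= g - a) lk'; rewrite subr_ge0 => /(_ ag).
rewrite bE in sN; have := ler_wpM2l (ler0n R l) sN.
by lra.
Qed.

Lemma hausdorff_measure_lower (s : R) : (0 < r)%N -> (r <= size G)%N -> 0 < s ->
  s * (N%:R * ln m%:R) <= ln (size G)%:R + (beta - 1) * ln r%:R ->
  hausdorff_measure s K <> 0%E.
Proof.
move=> r0 rsize s0 sN HK.
pose Q : R := ((2 * (4 * m ^ N)).+1 ^ 2)%:R.
have Q1 : 1 <= Q by rewrite ler1n expn_gt0.
pose P : R := (n ^ N)%:R `^ s.
have nN0 : (0 : R) < (n ^ N)%:R by rewrite ltr0n expn_gt0 n0.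
have P1 : 1 <= P.
  apply: (@le_trans _ _ ((n ^ N)%:R `^ 0)); first by rewrite powRr0.
  by apply: ler_powR; [rewrite ler1n expn_gt0 n0 | exact: ltW].
(* A box of radius e receives at most the proportion Q P e^s of the words, so boxes with sum of e^s
   at most eps would receive only half of them. P pays for rounding e to a power of n^N. *)
pose eps : R := (2 * Q * P)^-1.
have QP1 : 1 <= Q * P by rewrite -[leLHS]mulr1 ler_pM.
have QP0 : 0 < Q * P := lt_le_trans ltr01 QP1.
have eps0 : 0 < eps by rewrite invr_gt0 -mulrA mulr_gt0.
have eps1 : eps < 1 by rewrite invf_lt1 -mulrA ?mulr_gt0 //; lra.
have [x [e [e0 Kx esum]]] := hausdorff_measure0_boxes s0 HK eps0.
have [[q Kq] Kc _] := hK.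
have [N1 KN] := compact_boxes Kc Kx.
(* A radius below 1 is needed for the level in [exists_level]. *)
have e1 k : e k < 1.
  have : e k `^ s < 1.
    apply: le_lt_trans eps1; apply: le_trans (esum k.+1).
    by rewrite big_nat_recr //= lerDr sumr_ge0 // => i _; exact: powR_ge0.
  rewrite !ltNge; apply: contra => ek; apply: (@le_trans _ _ (e k `^ 0)); first by rewrite powRr0.
  by apply: ler_powR => //; exact: ltW.
have n2 : (2 <= n ^ N)%N := ltnW (leq_ltn_trans mN mnN).
have /choice[l hl] : forall k, exists l, (n ^ N)%:R ^- l.+1 <= e k /\ e k < (n ^ N)%:R ^- l.
  by move=> k; exact: exists_level.
(* The subcover is finite, so one word length exceeds all the weak levels involved. *)
pose B := (\max_(k < N1) level (l k))%N.
have kB (k : nat) : (k < N1)%N -> (level (l k) <= B)%N.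
  by move=> kN; exact: (leq_bigmax (Ordinal kN)).
pose cnt (k : nat) := count (fun v => `[< box (x k) (e k) (word_map sigma eta (flatten v) q) >]) (words G B).
have total : (size G ^ B <= \sum_(0 <= k < N1) cnt k)%N.
  have cntE k : cnt k = (\sum_(v <- words G B)
      if `[< box (x k) (e k) (word_map sigma eta (flatten v) q) >] then 1 else 0)%N.
    by rewrite /cnt -sum1_count big_mkcond.
  rewrite -size_words -sum1_size (eq_bigr _ (fun k _ => cntE k)).
  rewrite exchange_big /= big_seq [leqRHS]big_seq; apply: leq_sum => v vW.
  have [_ _ vD] := all_flatten_words GD vW.
  have [|k kN bk] := KN (word_map sigma eta (flatten v) q).
    by apply: (word_map_sub hK) => //; apply: sub_all vD => d /=; rewrite mem_enum.
  rewrite (bigD1_seq k) ?mem_index_iota ?iota_uniq //=.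
  by rewrite (asboolT bk).
have G0 : (0 : R) < (size G)%:R by rewrite ltr0n (leq_trans r0).
have rR : (0 : R) < r%:R by rewrite ltr0n.
have cntP k : (k < N1)%N -> (cnt k)%:R <= (size G)%:R ^+ B * (Q * P * e k `^ s).
  move=> kN; have [h1' h2'] := hl k.
  apply: le_trans (_ : ((2 * (4 * m ^ N)).+1 ^ 2 * (r ^ (level (l k) - l k) * size G ^ (B - level (l k))))%:R <= _).
    by rewrite ler_nat; apply: count_blocks_in_box => //; exact: kB.
  set c := level (l k); set d := l k.
  have dc : (d <= c)%N := leq_weak_level mN mnN d.
  have ndc : d%:R * ln n%:R <= c%:R * ln m%:R :> R.
    rewrite !mulr_natl -!lnXn ?ltr0n // ler_ln ?posrE ?exprn_gt0 ?ltr0n // -!natrX ler_nat.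
    rewrite -(leq_exp2r _ _ N0) -!expnM ![(_ * N)%N]mulnC !expnM; exact: (weak_levelP mN).
  (* Dividing the count in one box by #G^B leaves Q r^(c-d) #G^(-c), which this step compares with
     e^s. *)
  have key : r%:R ^+ (c - d) <= (size G)%:R ^+ c * (P * e k `^ s).
    have lnr : 0 <= ln r%:R :> R by rewrite ln_ge0 // ler1n.
    have lnrG : ln r%:R <= ln (size G)%:R :> R by rewrite ler_ln ?posrE // ler_nat.
    have be := block_exponent lnr lnrG sN ndc dc.
    have ge : expR (- (s * (d%:R * (N%:R * ln n%:R)))) <= P * e k `^ s.
      rewrite /P -powRM ?(ltW nN0) ?(ltW (e0 k)) //.
      have -> : expR (- (s * (d%:R * (N%:R * ln n%:R)))) = ((n ^ N)%:R ^- d) `^ s.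
        rewrite /powR gt_eqF ?invr_gt0 ?exprn_gt0 // lnV ?posrE ?exprn_gt0 // lnXn //.
        rewrite natrX lnXn ?ltr0n // -[ln n%:R *+ N]mulr_natl -[(N%:R * _) *+ d]mulr_natl.
        by rewrite mulrN.
      apply: ge0_ler_powR; rewrite ?nnegrE ?(ltW s0) ?invr_ge0 ?exprn_ge0 ?mulr_ge0 ?(ltW (e0 k)) //.
      by rewrite mulrC -ler_pdivrMr // -invfM -exprSr.
    apply: le_trans (ler_wpM2l _ ge); last by rewrite exprn_ge0.
    rewrite -[in leLHS](lnK rR) -[in leRHS](lnK G0) -!expRM_natl -expRD ler_expR.
    by lra.
  rewrite natrM -/Q natrM !natrX -[X in _ <= _ ^+ X * _](subnK (kB k kN)) -/c exprD.
  have QB : 0 <= Q * (size G)%:R ^+ (B - c) by rewrite mulr_ge0 ?exprn_ge0 // (le_trans ler01).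
  have := ler_wpM2l QB key; lra.
have : (size G ^ B)%:R <= (size G)%:R ^+ B * (Q * P * eps).
  apply: (@le_trans _ _ (\sum_(0 <= k < N1) (size G)%:R ^+ B * (Q * P * e k `^ s))).
    apply: (@le_trans _ _ (\sum_(0 <= k < N1) (cnt k)%:R)); first by rewrite -natr_sum ler_nat.
    by rewrite big_nat [leRHS]big_nat; apply: ler_sum => k /andP[_ kN]; exact: cntP.
  by rewrite -!mulr_sumr ler_pM2l ?exprn_gt0 // ler_pM2l.
have -> : Q * P * eps = 2^-1 by rewrite /eps; field; rewrite !gt_eqF //; lra.
rewrite natrX; have : 0 < (size G)%:R ^+ B :> R by rewrite exprn_gt0.
by lra.
Qed.

End LowerBound.

(** * Dimension formula *)

Lemma hausdorff_dim_carpet (R : realType) (m n : nat) (D : {set 'I_n * 'I_m})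
    (sigma eta : 'I_n * 'I_m -> bool) (h : nat) (K : set (R * R)) :
  (2 <= m)%N -> (m < n)%N -> (h <= 1)%N ->
  (forall d, d \in D -> half_row h (weak_row eta d)) ->
  reflected_carpet D sigma eta K ->
  hausdorff_dim K = ((ln m%:R)^-1 * ln (@row_sum R m n D eta))%:E.
Proof.
move=> hm hmn h1 Dh hK.
have [[q Kq] _ _] := hK.
have exD : exists d, d \in D by have [d dD _] := carpet_in hK Kq; exists d.
have Z1 : 1 <= @row_sum R m n D eta by have [d dD] := exD; exact: row_sum_ge1 dD.
have lnm : 0 < ln m%:R :> R by rewrite ln_gt0 // ltr1n.
rewrite mulrC; apply: hausdorff_dim_eq.
- by apply: divr_ge0; [exact: ln_ge0 | exact: ltW].
- by move=> s; exact: (hausdorff_measure_upper hm hmn h1 Dh hK).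
(* The mass distribution argument requires s > 0; s = 0 only uses that [K] is nonempty. *)
move=> s; rewrite le_eqVlt => /predU1P[<- _|s0]; first by apply: hausdorff_measure0_neq0; exists q.
rewrite ltr_pdivlMr // => sZ.
have [N [r [G [N0 [uG GD] /andP[r0 rG] fibre sN]]]] := exists_uniform_blocks hm hmn exD sZ.
exact: (hausdorff_measure_lower hm hmn h1 Dh hK N0 uG GD fibre r0 rG s0 sN).
Qed.

(** The digits of row (j, false) are those with column in [Cp j], and of row (j, true) those with
    column in [Cm j]. A row outside [J] contributes 0^beta = 0, as beta is nonzero. *)
Lemma row_sumE (R : realType) (m n : nat) (J : {set 'I_m}) (Cp Cm : 'I_m -> {set 'I_n})
    (D : {set 'I_n * 'I_m}) (eta : 'I_n * 'I_m -> bool) :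
  (2 <= m)%N -> (m < n)%N ->
  D = [set d : 'I_n * 'I_m | (d.2 \in J) && (d.1 \in Cp d.2 :|: Cm d.2)]%SET ->
  (forall (i : 'I_n) (j : 'I_m), j \in J -> i \in Cp j -> eta (i, j) = false) ->
  (forall (i : 'I_n) (j : 'I_m), j \in J -> i \in Cm j -> eta (i, j) = true) ->
  @row_sum R m n D eta =
  \sum_(j in J) (#|Cp j|%:R `^ (@log_ratio R m n) + #|Cm j|%:R `^ (@log_ratio R m n)).
Proof.
move=> hm hmn DE etap etam.
have b0 : @log_ratio R m n != 0 by rewrite gt_eqF // beta_gt0.
have cardE w : row_count D eta w = #|[set d in D | weak_row eta d == w]%SET|.
  by rewrite /row_count -size_filter cardE /enum_mem -enumT; congr size;
    rewrite -filter_predI; apply: eq_filter => d; rewrite /= !inE andbC.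
have imE (C : {set 'I_n}) (j : 'I_m) : #|[set (i, j) | i in C]%SET| = #|C|.
  by rewrite card_imset // => i i' [].
have rc j b : row_count D eta (j, b) = if j \in J then #|if b then Cm j else Cp j| else 0%N.
  rewrite cardE; case: ifPn => jJ; last first.
    by apply: eq_card0 => -[i j']; rewrite !inE DE !inE /weak_row /= xpair_eqE; case: eqP => [->|]; rewrite ?(negPf jJ) ?andbF.
  rewrite -(imE _ j); apply: eq_card => -[i j']; rewrite !inE DE !inE /weak_row /= xpair_eqE.
  apply/andP/imsetP => [[/andP[_ iC] /andP[/eqP jj /eqP <-]]|[i' iC [-> ->]]].
    rewrite {j'}jj in iC *; exists i => //.
    by case/orP: iC => iC; rewrite ?(etap _ _ jJ iC) ?(etam _ _ jJ iC).
  by move: iC; case: b => iC; rewrite jJ eqxx iC ?orbT ?(etap _ _ jJ iC) ?(etam _ _ jJ iC).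
rewrite /row_sum (eq_bigr (fun w => (row_count D eta (w.1, w.2))%:R `^ (@log_ratio R m n))); last by case.
rewrite -(pair_bigA _ (fun j b => (row_count D eta (j, b))%:R `^ (@log_ratio R m n))) /=.
rewrite [RHS]big_mkcond; apply: eq_bigr => j _; rewrite big_bool /= !rc.
by case: ifP => _; rewrite ?powR0 ?addr0 // addrC.
Qed.

(** Write (a+b)^p as a (a+b)^(p-1) + b (a+b)^(p-1) and use that x^(p-1) is strictly decreasing. *)
Lemma powRD_lt (R : realType) (a b p : R) : 0 < a -> 0 < b -> 0 < p -> p < 1 ->
  (a + b) `^ p < a `^ p + b `^ p.
Proof.
move=> a0 b0 p0 p1.
have dec x y : 0 < x -> 0 < y -> (x + y) `^ (p - 1) < x `^ (p - 1).
  move=> x0 y0; have xy0 : 0 < x + y by rewrite addr_gt0.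
  rewrite /powR !gt_eqF // ltr_expR ltr_nM2l ?subr_lt0 // ltr_ln ?posrE //.
  by rewrite ltrDl.
rewrite -(mulr_powRB1 (ltW (addr_gt0 a0 b0)) p0) -(mulr_powRB1 (ltW a0) p0).
rewrite -(mulr_powRB1 (ltW b0) p0) mulrDl ltrD // ltr_pM2l //; first exact: dec.
by rewrite addrC; exact: dec.
Qed.

Lemma powRnD_le (R : realType) (a b : nat) (p : R) : 0 < p -> p < 1 ->
  (a + b)%:R `^ p <= a%:R `^ p + b%:R `^ p.
Proof.
move=> p0 p1; case: (posnP a) => [->|a0]; first by rewrite add0n powR0 ?gt_eqF // add0r.
case: (posnP b) => [->|b0]; first by rewrite addn0 [0 `^ p]powR0 ?gt_eqF // addr0.
by rewrite natrD ltW // powRD_lt // ltr0n.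
Qed.

Lemma lower_half_row (m : nat) (w : 'I_m * bool) : (w.1 < m./2)%N -> half_row 0 w.
Proof.
rewrite /half_row mul0n mul1n => wm; have := odd_double_half m; rewrite -muln2.
by case: (odd m) => /=; lia.
Qed.

Lemma upper_half_row (m : nat) (w : 'I_m * bool) : (uphalf m <= w.1)%N -> half_row 1 w.
Proof.
rewrite /half_row mul1n uphalf_half => mw; have := ltn_ord w.1.
have := odd_double_half m; rewrite -muln2; move: mw.
by case: (odd m) => /=; lia.
Qed.

Theorem theorem1p3 (R : realType) (m n : nat) (hm : (2 <= m)%N) (hmn : (m < n)%N)
    (J : {set 'I_m}) (hJ0 : J != finset.set0)
    (hJ : (forall j : 'I_m, j \in J -> (j < m./2)%N) \/
          (forall j : 'I_m, j \in J -> (uphalf m <= j)%N))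
    (Cp Cm : 'I_m -> {set 'I_n})
    (hdisj : forall j : 'I_m, j \in J -> (Cp j :&: Cm j)%SET = finset.set0)
    (hne : forall j : 'I_m, j \in J -> (Cp j :|: Cm j)%SET != finset.set0)
    (D : {set 'I_n * 'I_m})
    (hD : D = [set d : 'I_n * 'I_m | (d.2 \in J) && (d.1 \in Cp d.2 :|: Cm d.2)]%SET)
    (sigma eta : 'I_n * 'I_m -> bool)
    (hetap : forall (i : 'I_n) (j : 'I_m), j \in J -> i \in Cp j -> eta (i, j) = false)
    (hetam : forall (i : 'I_n) (j : 'I_m), j \in J -> i \in Cm j -> eta (i, j) = true) :
  let beta : R := ln m%:R / ln n%:R in
  let value : R :=
    (ln m%:R)^-1 * ln (\sum_(j in J) ((#|Cp j|%:R `^ beta) + (#|Cm j|%:R `^ beta))) in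
  (forall K : set (R * R), reflected_carpet D sigma eta K ->
     hausdorff_dim K = value%:E) /\
  ((exists2 j : 'I_m, j \in J & (0 < #|Cp j| * #|Cm j|)%N) ->
     (ln m%:R)^-1 * ln (\sum_(j in J) ((#|Cp j| + #|Cm j|)%:R `^ beta)) < value).
Proof.
move=> beta value.
have b0 : 0 < beta := beta_gt0 hm hmn.
have b1 : beta < 1 := beta_lt1 hm hmn.
split.
  move=> K hK.
  have [h h1 Dh] : exists2 h, (h <= 1)%N & forall d, d \in D -> half_row h (weak_row eta d).
    case: hJ => hJ; [exists 0%N | exists 1%N] => // d; rewrite hD inE => /andP[/hJ dJ _].
      exact: (@lower_half_row m (weak_row eta d) dJ).
    exact: (@upper_half_row m (weak_row eta d) dJ).
  rewrite (hausdorff_dim_carpet hm hmn h1 Dh hK).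
  by rewrite (row_sumE R hm hmn hD hetap hetam).
move=> [j0 j0J]; rewrite muln_gt0 => /andP[p0 q0].
have lnm : 0 < ln m%:R :> R by rewrite ln_gt0 // ltr1n.
(* Strict subadditivity at [j0], where both counts are positive, and weak subadditivity at the other
   rows. *)
have lt : \sum_(j in J) ((#|Cp j| + #|Cm j|)%:R `^ beta) <
          \sum_(j in J) ((#|Cp j|%:R `^ beta) + (#|Cm j|%:R `^ beta)).
  rewrite (bigD1 j0) //= [ltRHS](bigD1 j0) //= ltr_leD //.
    by rewrite natrD powRD_lt // ltr0n.
  by apply: ler_sum => j _; exact: powRnD_le.
have pos : 0 < \sum_(j in J) ((#|Cp j| + #|Cm j|)%:R `^ beta).
  rewrite (bigD1 j0) //= ltr_pwDl ?sumr_ge0 //.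
  by rewrite powR_gt0 // ltr0n addn_gt0 p0.
by rewrite /value ltr_pM2l ?invr_gt0 // ltr_ln ?posrE // (lt_trans pos).
Qed.
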